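(* Let $s\in\mathbb{N}$, $S=\{1,\dots,s\}$, let $\mathcal{P}\subset[0,1)^s$ be a digital net over $\mathbb{Z}_2$ (base $b=2$), and let $\{\gamma_v\}_{v\subset S}$ be positive real numbers. Let $\alpha\in\mathbb{N}\cup\{\infty\}$ with $\alpha\ge 2$. Assume that the mixed partial derivatives of $f$ up to order $\alpha$ in each variable $x_i$ are continuous on $[0,1]^s$, and let $1\le p,q,q'\le\infty$ with $1/q+1/q'=1$. Then $$|\mathrm{Err}(f;\mathcal{P})|\le \|f\|_{\mathcal{B}_\alpha,\gamma,p,q'}\times \mathcal{W}_{\alpha,\gamma,q}(\mathcal{P}),$$ where $$\mathcal{W}_{\alpha,\gamma,q}(\mathcal{P})=\Bigg(\sum_{\emptyset\neq v\subset S}\Big(\gamma_v\sum_{\mathbf{k}_v\in\mathcal{P}_v^{\perp}}2^{-\mu'_\alpha(\mathbf{k}_v)}\Big)^{q}\Bigg)^{1/q},$$ $$\|f\|_{\mathcal{B}_\alpha,\gamma,p,q'}=\Bigg(\sum_{\emptyset\neq v\subset S}\Big(\gamma_v^{-1}2^{|v|/p}\sup_{\alpha_v\in\{1,\dots,\alpha\}^{|v|}}\|f^{(\alpha_v)}\|_p\Big)^{q'}\Bigg)^{1/q'},$$ with the obvious modifications if $p$, $q$ or $q'$ is infinite.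
   Context: $\mathbb{N}$ denotes the positive integers, $\mathbb{N}_0=\mathbb{N}\cup\{0\}$. Integration error: $\mathrm{Err}(f;\mathcal{P}):=\int_{[0,1)^s}f(\mathbf{x})\,d\mathbf{x}-\frac{1}{|\mathcal{P}|}\sum_{\mathbf{x}\in\mathcal{P}}f(\mathbf{x})$. Digital net (base 2): let $n\ge m\ge1$ be integers and $C_1,\dots,C_s$ be $n\times m$ matrices over $\mathbb{Z}_2=\mathbb{Z}/2\mathbb{Z}$. For an integer $0\le h<2^m$ write $h=\sum_{j=1}^m h_j2^{j-1}$ with $h_j\in\{0,1\}$, and set $\mathbf{h}=(h_1,\dots,h_m)$ as a row vector over $\mathbb{Z}_2$. For $1\le i\le s$ let $(y_{h,i,1},\dots,y_{h,i,n})=\mathbf{h}\cdot C_i^{\top}$ and $x_i(h)=\sum_{j=1}^n y_{h,i,j}2^{-j}\in[0,1)$, where $y_{h,i,j}$ is regarded as an element of $\{0,1\}\subset\mathbb{Z}$. The digital net is $\mathcal{P}=\{\mathbf{x}_0,\dots,\mathbf{x}_{2^m-1}\}$, $\mathbf{x}_h=(x_i(h))_{1\le i\le s}$ (points counted with multiplicity, $|\mathcal{P}|=2^m$). Dual net: $\mathcal{P}^{\perp}=\{\mathbf{k}=(k_1,\dots,k_s)\in\mathbb{N}_0^s : C_1^{\top}\vec{k}_1+\cdots+C_s^{\top}\vec{k}_s=\mathbf{0}\in\mathbb{Z}_2^m\}$, where for $k_i=\sum_{j\ge1}\kappa_{i,j}2^{j-1}$ (binary expansion) $\vec{k}_i=(\kappa_{i,1},\dots,\kappa_{i,n})^{\top}\in\mathbb{Z}_2^n$.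 For $\emptyset\ne v\subset S$ and $\mathbf{k}_v\in\mathbb{N}^{|v|}$ (indexed by $v$), $(\mathbf{k}_v;\mathbf{0})\in\mathbb{N}_0^s$ is the vector whose $j$th component is $k_j$ if $j\in v$ and $0$ otherwise; $\mathcal{P}_v^{\perp}:=\{\mathbf{k}_v\in\mathbb{N}^{|v|} : (\mathbf{k}_v;\mathbf{0})\in\mathcal{P}^{\perp}\}$ (all components are nonzero). Weight: for $(l_1,\dots,l_{|v|})\in\mathbb{N}^{|v|}$ with dyadic expansions $l_i=\sum_{j=1}^{N_i}2^{a_{i,j}}$, $a_{i,1}>\cdots>a_{i,N_i}\ge0$, $\mu'_\alpha((l_1,\dots,l_{|v|}))=\sum_{i=1}^{|v|}\sum_{j=1}^{\min(\alpha,N_i)}(a_{i,j}+2)$. Norm: for $\alpha_v=(\alpha_i)_{i\in v}$, $\|f^{(\alpha_v)}\|_p=\Big(\int_{[0,1)^{|v|}}\Big|\int_{[0,1)^{|S\setminus v|}}\frac{\partial^{|\alpha_v|}f}{\partial\mathbf{x}_{\alpha_v}}\,d\mathbf{x}_{S\setminus v}\Big|^p d\mathbf{x}_v\Big)^{1/p}$, where $\partial^{|\alpha_v|}f/\partial\mathbf{x}_{\alpha_v}$ is the mixed partial derivative of $f$ of order $\alpha_i$ in $x_i$ for $i\in v$ and order $0$ in the other variables (essential supremum over $\mathbf{x}_v$ if $p=\infty$). Conventions: ''mixed partial derivatives up to order $\alpha$ in each variable are continuous'' means that $\partial^{n_1+\cdots+n_s}f/\partial x_1^{n_1}\cdots\partial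 x_s^{n_s}$ exists and is continuous on $[0,1]^s$ for all integers $0\le n_i\le\alpha$ (all $n_i\in\mathbb{N}_0$ if $\alpha=\infty$). If $\alpha=\infty$, $\{1,\dots,\alpha\}$ means $\mathbb{N}$, and the norm $\|f\|_{\mathcal{B}_\alpha,\gamma,p,q'}$ may take the value $+\infty$. $1/\infty=0$; for $q=\infty$ or $q'=\infty$ the outer sum is replaced by a maximum over $v$. *)

(* Defs.v *)
From HB Require Import structures.
From mathcomp Require Import all_boot all_order all_algebra.
From mathcomp Require Import all_classical all_reals all_analysis.

Set Implicit Arguments.
Unset Strict Implicit.
Unset Printing Implicit Defensive.

Import Order.TTheory GRing.Theory Num.Theory.
Import numFieldNormedType.Exports.

Local Open Scope classical_set_scope.
Local Open Scope ring_scope.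

(* The smoothness parameter alpha in {1, 2, ...} \cup {oo} is an [option nat],
   with [None] standing for oo. *)
Definition le_order (n : nat) (alpha : option nat) : bool :=
  if alpha is Some a then (n <= a)%N else true.

Definition take_order (alpha : option nat) (l : seq nat) : seq nat :=
  if alpha is Some a then take a l else l.

(* Tuples of length |v| are indexed by the elements of v in increasing order:
   [component d t i] is the component of [t] with index i \in v. *)
Definition component (T : Type) (s : nat) (v : {set 'I_s}) (d : T)
    (t : #|v|.-tuple T) (i : 'I_s) : T :=
  nth d t (index i (enum v)).

(* (t_v; 0) *)
Definition extend0 (s : nat) (v : {set 'I_s}) (t : #|v|.-tuple nat)
    (i : 'I_s) : nat :=
  if i \in v then component 0%N t i else 0%N.

(* Lebesgue measure on the Borel sets of R^n: iterated product measure,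
   transported along the measurable bijection R * R^n -> R^(n+1). *)
Definition cons_pair (R : realType) (n : nat)
    (xt : measurableTypeR R * n.-tuple (measurableTypeR R)) :
    n.+1.-tuple (measurableTypeR R) :=
  [tuple of xt.1 :: xt.2].

Lemma measurable_cons_pair (R : realType) (n : nat) :
  measurable_fun [set: measurableTypeR R * n.-tuple (measurableTypeR R)]
    (@cons_pair R n).
Proof. exact: (measurable_cons measurable_fst measurable_snd). Qed.

Definition lebesgue_cons (R : realType) (n : nat)
    (mu : {measure set (n.-tuple (measurableTypeR R)) -> \bar R}) :
    set (n.+1.-tuple (measurableTypeR R)) -> \bar R :=
  pushforward (@lebesgue_measure R \x^ mu)%E (@cons_pair R n).

HB.instance Definition _ (R : realType) (n : nat)
    (mu : {measure set (n.-tuple (measurableTypeR R)) -> \bar R}) :=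
  Measure.copy (lebesgue_cons mu)
    (measure_function_pushforward__canonical__measure_function_Measure
       (@lebesgue_measure R \x^ mu)%E (@measurable_cons_pair R n)).

Fixpoint lebesgue_tuple (R : realType) (n : nat) :
    {measure set (n.-tuple (measurableTypeR R)) -> \bar R} :=
  if n is n'.+1 then [the measure _ _ of lebesgue_cons (lebesgue_tuple R n')]
  else [the measure _ _ of dirac [tuple]].

Definition cubeT (R : realType) (n : nat) :
    set (n.-tuple (measurableTypeR R)) :=
  [set t | forall i, 0 <= (tnth t i : R) < 1].

Definition closed_cube (R : realType) (s : nat) : set 'rV[R]_s :=
  [set x | forall i, 0 <= x 0 i <= 1].

Definition row_of_tuple (R : realType) (s : nat)
    (t : s.-tuple (measurableTypeR R)) : 'rV[R]_s :=
  \row_i tnth t i.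

(* the point with v-coordinates t and (S \ v)-coordinates u *)
Definition glue_point (R : realType) (s : nat) (v : {set 'I_s})
    (t : #|v|.-tuple (measurableTypeR R))
    (u : #|~: v|.-tuple (measurableTypeR R)) : 'rV[R]_s :=
  \row_i (if i \in v then component (0 : R) t i else component (0 : R) u i).

(* The nodes are counted with multiplicity. *)
Definition Err (R : realType) (s N : nat) (f : 'rV[R]_s -> R)
    (P : 'I_N -> 'rV[R]_s) : R :=
  Rintegral (lebesgue_tuple R s) (@cubeT R s) (f \o @row_of_tuple R s)
  - N%:R^-1 * \sum_(h < N) f (P h).

(* Digital nets in base 2; binary digits are indexed from 0, so that digit j
   is the coefficient of 2 ^ j, and row j of C i gives the digit of weight
   2 ^ - (j + 1). *)
Definition bit (k j : nat) : bool := odd (k %/ 2 ^ j).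

Definition bits (n k : nat) : 'rV['F_2]_n := \row_(j < n) (bit k j)%:R.

Definition digital_net (R : realType) (s n m : nat)
    (C : 'I_s -> 'M['F_2]_(n, m)) (h : 'I_(2 ^ m)) : 'rV[R]_s :=
  \row_i \sum_(j < n) (nat_of_ord ((bits m h *m (C i)^T) 0 j))%:R * 2 ^- j.+1.

Definition dual_net (s n m : nat) (C : 'I_s -> 'M['F_2]_(n, m)) :
    set ('I_s -> nat) :=
  [set k | \sum_i (C i)^T *m (bits n (k i))^T = 0].

Definition dual_net_on (s n m : nat) (C : 'I_s -> 'M['F_2]_(n, m))
    (v : {set 'I_s}) : set (#|v|.-tuple nat) :=
  [set k | (forall i, (0 < tnth k i)%N) /\ dual_net C (extend0 k)].

Arguments dual_net_on [s n m] C v _.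

(* Exponents a_1 > ... > a_N of the dyadic expansion of l; the bound l is
   enough since 2 ^ a <= l implies a < l. *)
Definition dyadic_exponents (l : nat) : seq nat :=
  rev [seq a <- iota 0 l | bit l a].

Definition mu' (alpha : option nat) (l : seq nat) : nat :=
  (\sum_(li <- l) \sum_(a <- take_order alpha (dyadic_exponents li)) (a + 2))%N.

(* Partial derivatives relative to [0,1]^s: the increments are restricted to
   those staying in the cube, so derivatives are one-sided on its boundary and
   only the values of f on the cube matter. *)
Definition partial_quotient (R : realType) (s : nat) (i : 'I_s)
    (f : 'rV[R]_s -> R) (x : 'rV[R]_s) (h : R) : R :=
  h^-1 * (f (x + h *: delta_mx 0 i) - f x).

Definition partial_increments (R : realType) (s : nat) (i : 'I_s)
    (x : 'rV[R]_s) : set_system R :=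
  within [set h | closed_cube (x + h *: delta_mx 0 i)] (0 : R)^'.

Definition partial (R : realType) (s : nat) (i : 'I_s)
    (f : 'rV[R]_s -> R) (x : 'rV[R]_s) : R :=
  lim (partial_quotient i f x @ partial_increments i x).

Definition has_partial (R : realType) (s : nat) (i : 'I_s)
    (f : 'rV[R]_s -> R) : Prop :=
  forall x, closed_cube x ->
    cvg (partial_quotient i f x @ partial_increments i x).

(* Iterated partial derivatives along a list of variables, the last variable
   of the list being differentiated first. *)
Definition partials (R : realType) (s : nat) (w : seq 'I_s)
    (f : 'rV[R]_s -> R) : 'rV[R]_s -> R :=
  foldr (@partial R s) f w.

Fixpoint has_partials (R : realType) (s : nat) (w : seq 'I_s)
    (f : 'rV[R]_s -> R) : Prop :=
  if w is i :: w' then has_partials w' f /\ has_partial i (partials w' f)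
  else True.

(* x_1, ..., x_1, ..., x_s, ..., x_s with x_i repeated n_i times *)
Definition variables (s : nat) (n : 'I_s -> nat) : seq 'I_s :=
  flatten [seq nseq (n i) i | i <- enum 'I_s].

Definition mixed_partial (R : realType) (s : nat) (n : 'I_s -> nat)
    (f : 'rV[R]_s -> R) : 'rV[R]_s -> R :=
  partials (variables n) f.

Definition continuous_mixed_partials (R : realType) (s : nat)
    (alpha : option nat) (f : 'rV[R]_s -> R) : Prop :=
  forall n : 'I_s -> nat, (forall i, le_order (n i) alpha) ->
    has_partials (variables n) f /\
    {within @closed_cube R s, continuous (mixed_partial n f)}.

(* || f^(alpha_v) ||_p; the function of x_v is extended by 0 outside
   [0,1)^|v|, which changes neither the integral nor the essential supremum
   of its absolute value. *)
Definition partial_norm (R : realType) (s : nat) (p : \bar R)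
    (f : 'rV[R]_s -> R) (v : {set 'I_s}) (a : #|v|.-tuple nat) : \bar R :=
  Lnorm (lebesgue_tuple R #|v|) p
    ((fun t : #|v|.-tuple (measurableTypeR R) =>
       \int[lebesgue_tuple R #|~: v|]_(u in @cubeT R #|~: v|)
         (mixed_partial (extend0 a) f (glue_point t u))%:E)%E
     \_ (@cubeT R #|v|)).

(* l^q norm over the nonempty subsets of S of a family of elements of
   [0, +oo] (q = -oo is meaningless) *)
Definition lq_norm (R : realType) (s : nat) (q : \bar R)
    (F : {set 'I_s} -> \bar R) : \bar R :=
  match q with
  | q'%:E => ((\sum_(v : {set 'I_s} | v != finset.set0) F v `^ q') `^ q'^-1)%E
  | +oo%E => \big[maxe/0%E]_(v : {set 'I_s} | v != finset.set0) F v
  | -oo%E => 0%E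
  end.

Definition W (R : realType) (s n m : nat) (alpha : option nat)
    (gamma : {set 'I_s} -> R) (q : \bar R)
    (C : 'I_s -> 'M['F_2]_(n, m)) : \bar R :=
  lq_norm q (fun v =>
    ((gamma v)%:E * \esum_(k in dual_net_on C v) (2 ^- mu' alpha k)%:E)%E).

(* p >= 1, so p^-1 is finite, with value 0 if p = +oo *)
Definition B_norm (R : realType) (s : nat) (alpha : option nat)
    (gamma : {set 'I_s} -> R) (p q' : \bar R) (f : 'rV[R]_s -> R) : \bar R :=
  lq_norm q' (fun v =>
    (((gamma v)^-1 * 2 `^ (#|v|%:R * fine (p^-1)%E))%:E *
     ereal_sup [set partial_norm p f a | a in
       [set a : #|v|.-tuple nat |
         forall i, (1 <= tnth a i)%N /\ le_order (tnth a i) alpha]])%E).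

(* Main.v *)
Require Import Defs.
From HB Require Import structures.
From mathcomp Require Import all_boot all_order all_algebra.
From mathcomp Require Import all_classical all_reals all_analysis.
From mathcomp Require Import measurable_realfun ess_sup_inf.
From mathcomp Require Import ring lra zify.

(* For a Walsh index k = 2^a_1 + ... + 2^a_N with a_1 > ... > a_N, the n-th
   iterated primitive (1 <= n <= N) of the Walsh function wal_k on [0,1] vanishes at
   both end points, is bounded by 2 c and has L^1 norm at most c, where
   c = 2^-((a_1 + 2) + ... + (a_n + 2)).  This is an induction on the binary
   digits of k: the graph of wal_(2k+b) consists of two copies of that of wal_k
   shrunk by 1/2, the second one with sign (-1)^b, and primitives behave well
   under this doubling.  Integrating by parts min(alpha, N) times in each
   variable and interpolating between the L^1 and the sup bound in Hoelder's
   inequality bounds the Walsh coefficient of f at k_v by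
   2^(|v|/p) ||f^(alpha_v)||_p 2^-mu'(k_v).

   The partial sum of the Walsh series over all k_i < 2^M is, at a node of the
   net, the mean of f over the dyadic cube of side 2^-M containing it, hence
   tends to f there; averaging over the nodes only keeps the k in the dual net.
   So Err is minus the limit of the finite sums of Walsh coefficients over the
   non-zero k in the dual net, and no convergence of the series is needed.
   Grouping by the support v of k and Hoelder's inequality for sums over v
   conclude. *)

Set Implicit Arguments.
Unset Strict Implicit.
Unset Printing Implicit Defensive.

Import Order.TTheory GRing.Theory Num.Theory.
Import numFieldNormedType.Exports.

Local Open Scope classical_set_scope.
Local Open Scope ring_scope.

(** * Means over the unit interval *)

(** The constants come from the lowest digit of k. Halving the graph costs a factor 1/2 per
    primitive, which matches the increase by one of every old exponent. A lowest digit 1 adds the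
    exponent 0 and one more primitive, that of a nonnegative function followed by its negative.
    Apart from the scaling it rises to half the mean of that function and returns to 0, and its mean
    is a quarter of it: hence the 2 in a + 2, and 2 c for the sup. The factor 2 does not accumulate,
    as each new primitive gets its sup bound from the L^1 bound of the preceding one. Interpolation
    gives 2^(1/p) c per variable.

    Two obstacles shape the rest. [f] is controlled only on the closed cube, so every function is
    composed with the projection [clamp] to become total. Derivatives are given only in the order of
    [variables], so integration by parts follows that order. Integrals are real iterated means of
    bounded measurable functions, a class stable under all operations used; [integral_averages]
    links them to the product measure of the statement. *)

Definition bounded_measurable (R : realType) d (T : measurableType d)
    (g : T -> R) : Prop :=
  measurable_fun [set: T] g /\ exists B, forall x, `|g x| <= B.

Section bounded_measurable.
Context (R : realType) d (T : measurableType d).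
Implicit Types (g h : T -> R).

Lemma bmM g h : bounded_measurable g -> bounded_measurable h ->
  bounded_measurable (fun x => g x * h x).
Proof.
move=> [mg [B hB]] [mh [B' hB']]; split; first exact: measurable_funM.
exists (B * B') => x; rewrite normrM; exact: ler_pM.
Qed.

Lemma bmD g h : bounded_measurable g -> bounded_measurable h ->
  bounded_measurable (fun x => g x + h x).
Proof.
move=> [mg [B hB]] [mh [B' hB']]; split; first exact: measurable_funD.
exists (B + B') => x; exact: le_trans (ler_normD _ _) (lerD _ _).
Qed.

Lemma bm_cst (c : R) : bounded_measurable (fun _ : T => c).
Proof. by split; [exact: measurable_cst|exists `|c|]. Qed.

Lemma bmZ (c : R) g : bounded_measurable g ->
  bounded_measurable (fun x => c * g x).
Proof. by move=> bg; apply: bmM => //; exact: bm_cst. Qed.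

Lemma bmN g : bounded_measurable g -> bounded_measurable (fun x => - g x).
Proof.
by move=> [mg [B hB]]; split; [exact: measurableT_comp|exists B => x; rewrite normrN].
Qed.

Lemma bm_norm g : bounded_measurable g -> bounded_measurable (fun x => `|g x|).
Proof.
by move=> [mg [B hB]]; split;
  [exact: measurableT_comp|exists B => x; rewrite normr_id].
Qed.

Lemma bm_comp d' (T' : measurableType d') (g : T -> R) (phi : T' -> T) :
  measurable_fun setT phi -> bounded_measurable g ->
  bounded_measurable (g \o phi).
Proof.
move=> mphi [mg [B hB]]; split; first exact: measurableT_comp.
by exists B => x; exact: hB.
Qed.

Lemma bm_integrable (mu : {measure set T -> \bar R}) A g :
  measurable A -> (mu A < +oo)%E -> bounded_measurable g ->
  mu.-integrable A (EFin \o g).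
Proof.
move=> mA muA [mg [B hB]]; apply: measurable_bounded_integrable => //.
  exact: measurable_funTS.
exists B; split; first exact: num_real.
by move=> M BM x _; apply: le_trans (ltW BM).
Qed.

End bounded_measurable.

Lemma bm_sum (R : realType) d (T : measurableType d) (I : Type) (r : seq I)
    (P : pred I) (g : I -> T -> R) :
  (forall i, bounded_measurable (g i)) ->
  bounded_measurable (fun x => \sum_(i <- r | P i) g i x).
Proof.
move=> bg; elim: r => [|i r IH].
  by under eq_fun do rewrite big_nil; exact: bm_cst.
under eq_fun do rewrite big_cons.
by case: (P i) => //; exact: bmD.
Qed.

Definition mean (R : realType) (g : R -> R) : R :=
  \int[lebesgue_measure]_(t in `[0%R, 1%R[%classic) g t.

Section mean.
Context (R : realType).
Implicit Types (g h : R -> R).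
Local Notation U := (`[(0 : R)%R, (1 : R)%R[%classic).
Local Notation lam := (@lebesgue_measure R).

Lemma lebesgue_unit : lam U = 1%E.
Proof. by rewrite lebesgue_measure_itv/= lte_fin ltr01 oppr0 adde0. Qed.

Lemma bm_integrable_unit g : bounded_measurable g ->
  lam.-integrable U (EFin \o g).
Proof.
move=> bg; apply: bm_integrable => //.
by move: lebesgue_unit => /= ->; exact: ltry.
Qed.

Lemma meanE g : bounded_measurable g ->
  (\int[lam]_(t in U) (g t)%:E = (mean g)%:E)%E.
Proof.
move=> bg; rewrite /mean /Rintegral fineK//.
by apply: integrable_fin_num => //; exact: bm_integrable_unit.
Qed.

Lemma eq_mean g h : (forall t, 0 <= t < 1 -> g t = h t) -> mean g = mean h.
Proof.
move=> gh; apply: eq_Rintegral => t; rewrite inE /= in_itv/=; exact: gh.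
Qed.

Lemma meanD g h : bounded_measurable g -> bounded_measurable h ->
  mean (fun t => g t + h t) = mean g + mean h.
Proof. by move=> bg bh; apply: RintegralD => //; exact: bm_integrable_unit. Qed.

Lemma meanB g h : bounded_measurable g -> bounded_measurable h ->
  mean (fun t => g t - h t) = mean g - mean h.
Proof. by move=> bg bh; apply: RintegralB => //; exact: bm_integrable_unit. Qed.

Lemma meanZ (c : R) g : bounded_measurable g ->
  mean (fun t => c * g t) = c * mean g.
Proof. by move=> bg; apply: RintegralZl => //; exact: bm_integrable_unit. Qed.

Lemma mean_cst (c : R) : mean (fun=> c) = c.
Proof.
by rewrite /mean Rintegral_cst// (congr1 fine lebesgue_unit : fine _ = 1) mulr1.
Qed.

Lemma mean_ge0 g : (forall t, 0 <= t < 1 -> 0 <= g t) -> 0 <= mean g.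
Proof. by move=> g0; apply: Rintegral_ge0 => t /=; rewrite in_itv; exact: g0. Qed.

Lemma le_mean g h : bounded_measurable g -> bounded_measurable h ->
  (forall t, 0 <= t < 1 -> g t <= h t) -> mean g <= mean h.
Proof.
move=> bg bh gh; apply: le_Rintegral => //; exact: bm_integrable_unit.
Qed.

Lemma ler_norm_mean g : bounded_measurable g ->
  `|mean g| <= mean (fun t => `|g t|).
Proof. by move=> bg; apply: le_normr_Rintegral => //; exact: bm_integrable_unit. Qed.

Lemma mean_norm_le g (B : R) : bounded_measurable g ->
  (forall t, 0 <= t < 1 -> `|g t| <= B) -> `|mean g| <= B.
Proof.
move=> bg gB; apply: le_trans (ler_norm_mean bg) _; rewrite -[leRHS]mean_cst.
by apply: le_mean => //; [exact: bm_norm|exact: bm_cst].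
Qed.

Lemma restrict_unit g t :
  ((fun x => (g x)%:E) \_ U) t = (g t * \1_U t)%:E.
Proof. by rewrite patchE indicE; case: (t \in U); rewrite ?mulr1 ?mulr0. Qed.

Lemma integral_mul_unit g (c : R) : bounded_measurable g ->
  (\int[lam]_t (g t * (c * \1_U t))%:E = (c * mean g)%:E)%E.
Proof.
move=> bg; rewrite -meanZ// -meanE; last exact: bmZ.
rewrite [RHS]integral_mkcond; apply: eq_integral => t _.
by rewrite restrict_unit; congr EFin; ring.
Qed.

Lemma bm_mean d (T : measurableType d) (G : T * R -> R) :
  bounded_measurable G -> bounded_measurable (fun z => mean (fun t => G (z, t))).
Proof.
move=> bG; have [mG [B hB]] := bG; split; last first.
  exists B => z; apply: mean_norm_le => //.
  by apply: bm_comp bG; exact: pair1_measurable.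
(* Tonelli gives measurability of the partial integrals of the positive and negative parts; the
   indicator of [0,1) inside the integrand turns the mean into an integral over the whole line. *)
pose H := fun zt : T * R => (G zt * \1_U zt.2)%:E.
have mH : measurable_fun setT H.
  apply/measurable_EFinP; apply: measurable_funM => //.
  by apply: measurableT_comp => //; exact: measurable_fun_indic.
have mFp := @measurable_fun_fubini_tonelli_F _ _ T (measurableTypeR R) R lam
  H^\+%E (measurable_funepos mH) (fun x => funepos_ge0 H x).
have mFn := @measurable_fun_fubini_tonelli_F _ _ T (measurableTypeR R) R lam
  H^\-%E (measurable_funeneg mH) (fun x => funeneg_ge0 H x).
have := emeasurable_funB mFp mFn.
rewrite (_ : _ \- _ = fun z => (mean (fun t => G (z, t)))%:E)%E.
  by move/measurable_EFinP.
apply/funext => z; rewrite /= /fubini_F.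
transitivity (\int[lam]_t H (z, t))%E.
  rewrite [RHS]integralE.
  by congr (_ - _)%E; apply: eq_integral => t _; rewrite ?funeposE ?funenegE.
rewrite -[mean _]mul1r -integral_mul_unit; last first.
  by apply: bm_comp bG; exact: pair1_measurable.
by apply: eq_integral => t _; rewrite /H mul1r.
Qed.

Lemma mean_swap (G : R * R -> R) : bounded_measurable G ->
  mean (fun x => mean (fun y => G (x, y))) =
  mean (fun y => mean (fun x => G (x, y))).
Proof.
move=> bG; have [mG [B hB]] := bG.
pose H := fun xy : R * R => (G xy * (\1_U xy.1 * \1_U xy.2))%:E.
have mH : measurable_fun setT H.
  apply/measurable_EFinP; apply: measurable_funM => //; apply: measurable_funM.
    by apply: measurableT_comp => //; exact: measurable_fun_indic.
  by apply: measurableT_comp => //; exact: measurable_fun_indic.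
have bGs : bounded_measurable (fun yx : R * R => G (yx.2, yx.1)).
  by apply: (bm_comp _ bG); exact: measurable_swap.
have E (g h : R -> R) : bounded_measurable h ->
    (forall x, g x = \1_U x * h x) -> (\int[lam]_x (g x)%:E = (mean h)%:E)%E.
  move=> bh gh; rewrite -[mean h]mul1r -integral_mul_unit//.
  by apply: eq_integral => x _; rewrite gh mul1r mulrC.
have E1 : (\int[lam]_x \int[lam]_y H (x, y) =
    (mean (fun x => mean (fun y => G (x, y))))%:E)%E.
  rewrite -(E (fun x => \1_U x * mean (fun y => G (x, y))))//; last exact: bm_mean.
  apply: eq_integral => x _; rewrite -integral_mul_unit//.
  by apply: bm_comp bG; exact: pair1_measurable.
have E2 : (\int[lam]_y \int[lam]_x H (x, y) =
    (mean (fun y => mean (fun x => G (x, y))))%:E)%E.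
  rewrite -(E (fun y => \1_U y * mean (fun x => G (x, y))))//; last first.
    exact: (bm_mean bGs).
  apply: eq_integral => y _; rewrite -integral_mul_unit//.
    by apply: eq_integral => x _; rewrite /H (mulrC (\1_U x)).
  by apply: bm_comp bG; exact: pair2_measurable.
apply: EFin_inj; rewrite -E1 -E2; apply: Fubini.
apply/integrable12ltyP => //.
have bN := bm_norm bG.
apply: (@le_lt_trans _ _ (mean (fun x => mean (fun y => `|G (x, y)|)))%:E);
  last exact: ltry.
rewrite -(E (fun x => \1_U x * mean (fun y => `|G (x, y)|)))//; last first.
  exact: (bm_mean bN).
rewrite le_eqVlt; apply/orP; left; apply/eqP; apply: eq_integral => x _.
rewrite -integral_mul_unit; last first.
  by apply: (@bm_comp _ _ _ _ _ (fun z => `|G z|)) => //; exact: pair1_measurable.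
apply: eq_integral => y _; rewrite /H/= normrM (ger0_norm (mulr_ge0 _ _))//.
Qed.

End mean.

Lemma measurable_affine (R : realType) (a b : R) :
  measurable_fun [set: R] (fun t : R => a * t + b).
Proof.
by apply: measurable_funD; [apply: measurable_funM|];
  by [exact: measurable_cst|exact: measurable_id].
Qed.

Lemma measurable_scale (R : realType) (a : R) :
  measurable_fun [set: R] (fun t : R => a * t).
Proof. by apply: measurable_funM; [exact: measurable_cst|exact: measurable_id]. Qed.

(** * Dyadic halving of the unit interval *)

Section halving.
Context (R : realType).
Implicit Types (g h : R -> R).
Local Notation lam := (@lebesgue_measure R).

(** Half the image of Lebesgue measure under t -> t/2 + c. It gives every interval its length, hence
    is Lebesgue measure: this is the change of variables behind [mean_halving]. *)
Let halved (c : R) : {measure set (measurableTypeR R) -> \bar R} :=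
  [the measure _ _ of mscale (2^-1)%:nng
    (measure_function_pushforward__canonical__measure_function_Measure lam
       (@measurable_affine R 2^-1 c :
         @measurable_fun _ _ (measurableTypeR R) (measurableTypeR R) setT
           (fun t : R => 2^-1 * t + c)))].

Let lebesgue_halving (c : R) (A : set (measurableTypeR R)) : measurable A ->
  lam A = halved c A.
Proof.
apply: (@lebesgue_measure_unique R (halved c)).
move=> X [[a b] /= ab <-].
rewrite /halved /mscale/= /pushforward.
rewrite (_ : _ @^-1` _ = `]2 * (a - c), 2 * (b - c)]%classic); last first.
  apply/seteqP; split => t /=; rewrite !in_itv/=; lra.
rewrite !lebesgue_measure_itv/= !lte_fin ltr_pM2l// ltrD2r.
case: ifPn => _; last by rewrite mule0.
rewrite -!EFinB -EFinM; congr EFin; lra.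
Qed.

Let mean_half (D : set (measurableTypeR R)) g (c : R) :
  measurable D -> measurable_fun setT g ->
  (forall x, 0 <= g x) ->
  (\int[lam]_(y in D) (g y)%:E = (2^-1)%:E *
    \int[lam]_(t in (fun t : R => (2^-1 * t + c)%R) @^-1` D)
      (g (2^-1 * t + c)%R)%:E)%E.
Proof.
move=> mD mg g0; have mphi := @measurable_affine R 2^-1 c.
rewrite (@eq_measure_integral _ (measurableTypeR R) R D (halved c));
  last by move=> A mA _; exact: (lebesgue_halving c mA).
have mgE : measurable_fun D (EFin \o g : measurableTypeR R -> \bar R).
  by apply/measurable_EFinP; exact: measurable_funTS.
rewrite ge0_integral_mscale//; last by move=> x _; rewrite lee_fin.
rewrite (@ge0_integral_pushforward _ _ (measurableTypeR R)
  (measurableTypeR R))//.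
by move=> y _; rewrite lee_fin.
Qed.

Lemma mean_halving g : bounded_measurable g ->
  mean g = 2^-1 * (mean (fun t => g (2^-1 * t)) +
                   mean (fun t => g (2^-1 * t + 2^-1))).
Proof.
(* Adding the bound of [g] to [g] changes both sides by the same constant, so [g] may be assumed
   nonnegative. *)
move=> bg; wlog g0 : g bg / forall x, 0 <= g x.
  move=> H; have [mg [B hB]] := bg.
  have := H (fun t => g t + B) (bmD bg (bm_cst _ B)).
  have m1 := @measurable_affine R 2^-1 0; have m2 := @measurable_affine R 2^-1 2^-1.
  have b1 : bounded_measurable (fun t : R => g (2^-1 * t)).
    by rewrite (_ : (fun _ => _) = g \o (fun t => 2^-1 * t + 0));
      [exact: bm_comp|apply/funext => t /=; rewrite addr0].
  have b2 : bounded_measurable (fun t : R => g (2^-1 * t + 2^-1)).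
    exact: (bm_comp m2).
  rewrite !meanD ?mean_cst//; try exact: bm_cst.
  suff g0 x : 0 <= g x + B by move=> /(_ g0); lra.
  by move: (hB x); rewrite ler_norml => /andP[]; lra.
have [mg _] := bg.
apply: EFin_inj; rewrite -meanE//.
rewrite (@itv_bndbnd_setU _ _ _ (BLeft (2^-1 : R))); last 2 first.
- by rewrite bnd_simp.
- by rewrite bnd_simp; lra.
rewrite ge0_integral_setU//=; last 3 first.
- by apply/measurable_EFinP; exact: measurable_funTS.
- by move=> x _; rewrite lee_fin.
- apply/disj_setPS => y [/=]; rewrite !in_itv/= => /andP[_ h1] /andP[h2 _].
  by move: h1; rewrite ltNge h2.
rewrite (@mean_half `[0%R, 2^-1%R[%classic _ 0)//.
rewrite (@mean_half `[2^-1%R, 1%R[%classic _ 2^-1)//.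
rewrite (_ : _ @^-1` _ = `[0, 1[%classic); last first.
  by apply/seteqP; split => t /=; rewrite !in_itv/=; lra.
rewrite (_ : (fun t : R => 2^-1 * t + 2^-1) @^-1` _ = `[0, 1[%classic); last first.
  by apply/seteqP; split => t /=; rewrite !in_itv/=; lra.
have E c : (\int[lam]_(t in `[0%R, 1%R[) (g (2^-1 * t + c)%R)%:E =
    (mean (fun t => g (2^-1 * t + c)))%:E)%E.
  by rewrite meanE//; apply: (bm_comp _ bg); exact: measurable_affine.
rewrite !E -!EFinM -EFinD mulrDr; congr EFin; congr (_ * _ + _).
by apply: eq_mean => t _; rewrite addr0.
Qed.

End halving.

(** The primitive vanishing at 0, extended to the whole line: it is 0 left of the unit interval and
    constantly [mean w] right of it. As a mean over a fixed interval it inherits measurability and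
    Fubini from [mean]. *)
Definition prim (R : realType) (w : R -> R) (u : R) : R :=
  mean (fun t => if t < u then w t else 0).

Section primitive.
Context (R : realType).
Implicit Types (g w : R -> R).

Lemma measurable_if_lt d (T : measurableType d) (a b g h : T -> R) :
  measurable_fun setT a -> measurable_fun setT b ->
  measurable_fun setT g -> measurable_fun setT h ->
  measurable_fun setT (fun x => if a x < b x then g x else h x).
Proof.
move=> ma mb mg mh; apply: measurable_fun_ifT => //.
exact: measurable_fun_ltr.
Qed.

Lemma bm_if_lt d (T : measurableType d) (a b g h : T -> R) :
  measurable_fun setT a -> measurable_fun setT b ->
  bounded_measurable g -> bounded_measurable h ->
  bounded_measurable (fun x => if a x < b x then g x else h x).
Proof.
move=> ma mb [mg [B hB]] [mh [B' hB']]; split; first exact: measurable_if_lt.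
exists (Order.max B B') => x; rewrite le_max.
by case: ifP; rewrite ?hB ?hB' ?orbT.
Qed.

Lemma bm_prim w : bounded_measurable w -> bounded_measurable (prim w).
Proof.
move=> bw.
apply: (@bm_mean R _ R (fun ut : R * R => if ut.2 < ut.1 then w ut.2 else 0)).
apply: bm_if_lt => //; last exact: bm_cst.
exact: (bm_comp measurable_snd bw).
Qed.

Lemma bm_if_ltl w (u : R) : bounded_measurable w ->
  bounded_measurable (fun t : R => if t < u then w t else 0).
Proof.
by move=> bw; apply: bm_if_lt => //; exact: bm_cst.
Qed.

Lemma bm_if_ltr w (u : R) : bounded_measurable w ->
  bounded_measurable (fun t : R => if u < t then w t else 0).
Proof.
by move=> bw; apply: bm_if_lt => //; exact: bm_cst.
Qed.

Lemma prim_ge1 w u : 1 <= u -> prim w u = mean w.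
Proof.
by move=> u1; apply: eq_mean => t /andP[_ t1]; rewrite (lt_le_trans t1 u1).
Qed.

Lemma prim_le0 w u : u <= 0 -> prim w u = 0.
Proof.
move=> u0; rewrite -[RHS](mean_cst (0 : R)); apply: eq_mean => t /andP[t0 _].
by rewrite ltNge (le_trans u0 t0).
Qed.

(** Fubini on the triangle t < u. The function [w] is only bounded and measurable, so its primitive
    is never differentiated: regularity is asked of [g] alone, through its increments. The boundary
    term g(1) [mean w] is 0. *)
Lemma mean_by_parts g g' w :
  bounded_measurable g -> bounded_measurable g' -> bounded_measurable w ->
  mean w = 0 ->
  (forall t : R, 0 <= t < 1 -> g 1 - g t = mean (fun u => if t < u then g' u else 0)) ->
  mean (fun t => g t * w t) = - mean (fun u => g' u * prim w u).
Proof.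
move=> bg bg' bw w0 gE.
pose G := fun tu : R * R => if tu.1 < tu.2 then w tu.1 * g' tu.2 else 0.
have bG : bounded_measurable G.
  apply: bm_if_lt => //; last exact: bm_cst.
  by apply: bmM; [exact: (bm_comp measurable_fst bw)|exact: (bm_comp measurable_snd bg')].
have H : mean (fun t => g t * w t) =
    mean (fun t => g 1 * w t - mean (fun u => G (t, u))).
  apply: eq_mean => t t01.
  rewrite (_ : mean _ = w t * (g 1 - g t)); first by ring.
  rewrite gE// -meanZ; last exact: bm_if_ltr.
  by apply: eq_mean => u _; rewrite /G/=; case: ifP => _; rewrite ?mulr0.
rewrite H meanB; [|exact: bmZ|exact: bm_mean].
rewrite meanZ// w0 mulr0 sub0r mean_swap//; congr (- _).
apply: eq_mean => u _; rewrite /prim -meanZ; last exact: bm_if_ltl.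
by apply: eq_mean => t _; rewrite /G/=; case: ifP => _; rewrite ?mulr0// mulrC.
Qed.

(** Derivatives are two-sided only inside the interval; continuity of [g] takes care of the end
    points. *)
Lemma increment_mean g g' : continuous g -> continuous g' ->
  bounded_measurable g' ->
  (forall t : R, 0 < t < 1 -> is_derive t 1 g (g' t)) ->
  forall t : R, 0 <= t < 1 -> g 1 - g t = mean (fun u => if t < u then g' u else 0).
Proof.
move=> cg cg' bg' dg t /andP[t0 t1].
have tx1 (x : R) : t < x -> x < 1 -> is_derive x 1 g (g' x).
  by move=> tx x1; apply: dg; rewrite (le_lt_trans t0 tx).
have bw := @bm_if_ltr g' t bg'.
have H : (\int[lebesgue_measure]_(x in `[t, 1%R]) (g' x)%:E =
    (mean (fun u => if t < u then g' u else 0))%:E)%E.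
  rewrite -meanE//.
  rewrite -integral_itv_obnd_cbnd; last first.
    by apply/measurable_EFinP; apply: measurable_funTS; case: bg'.
  rewrite -integral_itv_bndo_bndc; last first.
    by apply/measurable_EFinP; apply: measurable_funTS; case: bg'.
  rewrite [LHS]integral_mkcond [RHS]integral_mkcond; apply: eq_integral => x _.
  rewrite !patchE !mem_setE !in_itv/=.
  case: (ltP t x) => tx /=; last by case: ifP.
  by rewrite (ltW (le_lt_trans t0 tx)).
apply: EFin_inj; rewrite EFinB -H; apply/esym/continuous_FTC2 => //.
- by apply: continuous_subspaceT => x; exact: cg'.
- split.
  + move=> x; rewrite in_itv/= => /andP[tx x1].
    by have [] := tx1 x tx x1.
  + by apply: cvg_at_right_filter; exact: cg.
  + by apply: cvg_at_left_filter; exact: cg.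
- move=> x; rewrite in_itv/= => /andP[tx x1].
  by have ? := tx1 x tx x1; rewrite derive1E derive_val.
Qed.

End primitive.

(** * Walsh functions and their primitives *)

Section exponents.
Local Open Scope nat_scope.

(** Same list as [dyadic_exponents] when k < 2^M, but with a bound on the number of digits that is
    independent of [k], so that induction on [M] can remove the lowest digit. *)
Definition exponents (M k : nat) : seq nat := rev [seq a <- iota 0 M | bit k a].

Lemma bitS k j : bit k j.+1 = bit k./2 j.
Proof. by rewrite /bit expnS divnMA divn2. Qed.

Lemma bit0 k : bit k 0 = odd k.
Proof. by rewrite /bit expn0 divn1. Qed.

Lemma bit_lt k j : bit k j -> 2 ^ j <= k.
Proof.
by rewrite /bit leqNgt; apply: contraL => kj; rewrite divn_small.
Qed.

(** The order is decreasing, so the lowest digit comes last and is not seen by the shorter prefixes,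
    whose exponents merely increase by one. *)
Lemma exponentsS M k :
  exponents M.+1 k = map S (exponents M k./2) ++ nseq (odd k) 0.
Proof.
rewrite /exponents/= bit0 -[iota 1 M]/(iota (1 + 0) M) iotaDl filter_map map_rev.
have -> : [seq x <- iota 0 M | preim [eta addn 1] [eta bit k] x] =
          [seq a <- iota 0 M | bit k./2 a].
  by apply: eq_filter => a /=; rewrite add1n bitS.
rewrite (eq_map (fun a => add1n a)).
by case: (odd k); rewrite ?rev_cons -?cats1 ?cats0.
Qed.

Lemma dyadic_exponentsE M k : k < 2 ^ M -> dyadic_exponents k = exponents M k.
Proof.
move=> kM; rewrite /dyadic_exponents /exponents; congr rev.
(* Places beyond the highest digit contribute nothing; both ranges are compared with the larger
   one. *)
have H L L' : L <= L' -> (forall a, bit k a -> a < L) ->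
    [seq a <- iota 0 L | bit k a] = [seq a <- iota 0 L' | bit k a].
  move=> LL HL; rewrite -(subnKC LL) iotaD filter_cat.
  rewrite [X in _ = _ ++ X](_ : _ = [::]) ?cats0//.
  apply/eqP; rewrite -size_eq0 size_filter -leqn0 leqNgt -has_count.
  apply/hasPn => a; rewrite mem_iota add0n => /andP[la _].
  by apply/negP => /HL; lia.
rewrite (H k (maxn k M)) ?leq_maxl// ?(H M (maxn k M)) ?leq_maxr// => a /bit_lt ka.
  by rewrite -(ltn_exp2l _ _ (leqnn 2)) (leq_ltn_trans ka).
exact: leq_trans (ltn_expl a (leqnn 2)) ka.
Qed.

Definition weight (l : seq nat) : nat := \sum_(a <- l) (a + 2).

Lemma weight_cat l l' : weight (l ++ l') = weight l + weight l'.
Proof. exact: big_cat. Qed.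

Lemma weight_mapS l : weight (map S l) = weight l + size l.
Proof.
rewrite /weight big_map; elim: l => [|a l IH]; first by rewrite !big_nil.
by rewrite !big_cons IH/=; lia.
Qed.

End exponents.

Section walsh.
Context (R : realType).
Implicit Types (g : R -> R).

Definition stretch (e : R) g (x : R) : R :=
  if x < 2^-1 then g (2 * x) else e * g (2 * x - 1).

Lemma bm_stretch e g : bounded_measurable g -> bounded_measurable (stretch e g).
Proof.
move=> bg; apply: bm_if_lt => //.
- exact: (bm_comp (@measurable_scale R 2) bg).
- by apply: bmZ; exact: (bm_comp (@measurable_affine R 2 (- 1)) bg).
Qed.

Lemma mean_stretch e g : bounded_measurable g ->
  mean (stretch e g) = 2^-1 * ((1 + e) * mean g).
Proof.
move=> bg; rewrite mean_halving; last exact: bm_stretch.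
congr (_ * _); rewrite mulrDl mul1r -meanZ//; congr (_ + _); apply: eq_mean => t /andP[t0 t1].
  by rewrite /stretch ifT; [congr g; lra|lra].
by rewrite /stretch ifF; [congr (_ * g _); lra|apply/negbTE; rewrite -leNgt; lra].
Qed.

Lemma prim_stretch e g u : bounded_measurable g ->
  prim (stretch e g) u = 2^-1 * (prim g (2 * u) + e * prim g (2 * u - 1)).
Proof.
move=> bg; rewrite /prim mean_halving; last exact/bm_if_ltl/bm_stretch.
congr (_ * _); rewrite -meanZ; last exact: bm_if_ltl.
congr (_ + _); apply: eq_mean => t /andP[t0 t1].
  rewrite /stretch (_ : (2^-1 * t < u) = (t < 2 * u)); last first.
    by apply/idP/idP; lra.
  by case: ifP => // _; rewrite ifT; [congr g; lra|lra].
rewrite /stretch (_ : (2^-1 * t + 2^-1 < u) = (t < 2 * u - 1)); last first.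
  by apply/idP/idP; lra.
case: ifP => // _; rewrite ?mulr0//.
by rewrite ifF; [congr (_ * g _); lra|apply/negbTE; rewrite -leNgt; lra].
Qed.

(** When [g] has mean 0, the primitive is back at 0 at the point 1/2, so the second copy starts
    afresh; the factor 1/2 is the horizontal contraction. *)
Lemma prim_stretch0 e g : bounded_measurable g -> mean g = 0 ->
  prim (stretch e g) = fun u => 2^-1 * stretch e (prim g) u.
Proof.
move=> bg g0; apply/funext => u; rewrite prim_stretch// /stretch.
congr (_ * _); case: ltP => u2.
  by rewrite (@prim_le0 _ _ (2 * u - 1)) ?mulr0 ?addr0//; lra.
by rewrite prim_ge1 ?g0 ?add0r//; lra.
Qed.

Lemma primZ c g : bounded_measurable g ->
  prim (fun t => c * g t) = fun u => c * prim g u.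
Proof.
move=> bg; apply/funext => u; rewrite /prim -meanZ; last exact: bm_if_ltl.
by apply: eq_mean => t _; case: ifP; rewrite ?mulr0.
Qed.

(** On [0,1) and for k < 2^M this is the Walsh function wal_k: the lowest digit of [k] gives the
    sign on the right half, and the higher digits act on the rescaled point. All indices share the
    digit bound [M]. *)
Fixpoint walsh (M k : nat) : R -> R :=
  if M is M'.+1 then stretch ((-1) ^+ odd k) (walsh M' k./2) else fun=> 1.

Definition walsh_prim (M k n : nat) : R -> R := iter n (@prim R) (walsh M k).

Lemma bm_walsh M k : bounded_measurable (walsh M k).
Proof. by elim: M k => [|M IH] k /=; [exact: bm_cst|exact: bm_stretch]. Qed.

Lemma bm_walsh_prim M k n : bounded_measurable (walsh_prim M k n).
Proof. by elim: n => [|n IH]; [exact: bm_walsh|exact: bm_prim]. Qed.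

Lemma le_prim g u v : bounded_measurable g -> (forall x, 0 <= g x) -> u <= v ->
  prim g u <= prim g v.
Proof.
move=> bg g0 uv; apply: le_mean; [exact: bm_if_ltl..|].
by move=> t _; case: ltP => [tu|_]; [rewrite (lt_le_trans tu uv)|case: ifP].
Qed.

Lemma prim_ge0 g u : (forall x, 0 <= g x) -> 0 <= prim g u.
Proof. by move=> g0; apply: mean_ge0 => t _; case: ifP. Qed.

Lemma prim_le g u : bounded_measurable g -> (forall x, 0 <= g x) ->
  prim g u <= mean g.
Proof.
move=> bg g0; apply: le_mean; [exact: bm_if_ltl|by []|].
by move=> t _; case: ifP.
Qed.

(** As long as the preceding primitives have mean 0, [prim_stretch0] applies at each integration,
    which costs one factor 1/2. *)
Lemma walsh_primS M k n :
  (forall j, (j < n)%N -> mean (walsh_prim M k./2 j) = 0) ->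
  walsh_prim M.+1 k n =
    fun x => 2 ^- n * stretch ((-1) ^+ odd k) (walsh_prim M k./2 n) x.
Proof.
elim: n => [|n IH] H.
  by apply/funext => x; rewrite /walsh_prim/= expr0 invr1 mul1r.
rewrite {1}/walsh_prim iterS -/(walsh_prim M.+1 k n) IH; last first.
  by move=> j jn; apply: H; rewrite ltnS ltnW.
rewrite primZ; last exact/bm_stretch/bm_walsh_prim.
rewrite prim_stretch0; [|exact: bm_walsh_prim|exact: H].
by apply/funext => x; rewrite exprSr invfM mulrA.
Qed.

(** At t/2 and at (t+1)/2 the primitive takes the values [prim g t] / 2 and ([mean g] - [prim g t])
    / 2, whose sum does not depend on t. *)
Let mean_prim_odd g : bounded_measurable g ->
  mean (prim (stretch (-1) g)) = 2^-1 * (2^-1 * mean g).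
Proof.
move=> bg; rewrite mean_halving; last exact/bm_prim/bm_stretch.
have bp := bm_prim bg.
rewrite -meanD; last 2 first.
- exact: (bm_comp (@measurable_scale R 2^-1) (bm_prim (bm_stretch _ bg))).
- exact: (bm_comp (@measurable_affine R 2^-1 2^-1) (bm_prim (bm_stretch _ bg))).
congr (_ * _); rewrite -[RHS]mean_cst; apply: eq_mean => t /andP[t0 t1].
rewrite !prim_stretch// (@prim_le0 _ _ (2 * (2^-1 * t) - 1)); last by lra.
rewrite (@prim_ge1 _ _ (2 * (2^-1 * t + 2^-1))); last by lra.
have -> : 2 * (2^-1 * t) = t by lra.
have -> : 2 * (2^-1 * t + 2^-1) - 1 = t by lra.
ring.
Qed.

(** The nonnegativity of the last primitive keeps the induction going: after a doubling with sign -1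
    the next primitive is again nonnegative, because [prim] of a nonnegative function is monotone,
    and it is at most half the mean. *)
Lemma walsh_prim_bounds M k (l := exponents M k) :
  [/\ forall n, (n < size l)%N -> mean (walsh_prim M k n) = 0,
      forall n, (n <= size l)%N ->
        mean (fun x => `|walsh_prim M k n x|) <= 2 ^- weight (take n l),
      forall n, (0 < n <= size l)%N -> forall x,
        `|walsh_prim M k n x| <= 2 * 2 ^- weight (take n l) &
      forall x, 0 <= walsh_prim M k (size l) x].
Proof.
rewrite {}/l; elim: M k => [|M IH] k.
  split => //= [[|n]// _|n].
    rewrite /weight big_nil expr0 invr1 (_ : (fun _ => _) = fun=> 1) ?mean_cst//.
    by apply/funext => x; rewrite /walsh_prim/= normr1.
  by move=> /andP[] /[swap]; rewrite leqn0 => /eqP ->.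
have [IH0 IH1 IH2 IH3] := IH k./2.
set l' := exponents M k./2 in IH0 IH1 IH2 IH3 *.
have sl : size (exponents M.+1 k) = (size l' + odd k)%N.
  by rewrite exponentsS size_cat size_map size_nseq.
have KE n : (n <= size l')%N -> walsh_prim M.+1 k n =
    fun x => 2 ^- n * stretch ((-1) ^+ odd k) (walsh_prim M k./2 n) x.
  by move=> nl; apply: walsh_primS => j jn; apply: IH0; exact: leq_trans nl.
have wE n : (n <= size l')%N ->
    weight (take n (exponents M.+1 k)) = (weight (take n l') + n)%N.
  move=> nl; rewrite exponentsS takel_cat ?size_map// -map_take weight_mapS.
  by rewrite size_take_min (minn_idPl nl).
have e1 : `|(-1) ^+ odd k : R| = 1 by rewrite normrX normrN1 expr1n.
have cE n : (n <= size l')%N -> (2 ^- weight (take n (exponents M.+1 k)) : R) =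
    2 ^- n * 2 ^- weight (take n l').
  by move=> nl; rewrite wE// exprD invfM mulrC.
have H1 n : (n <= size l')%N -> mean (fun x => `|walsh_prim M.+1 k n x|) <=
    2 ^- weight (take n (exponents M.+1 k)).
  move=> nl; rewrite KE// cE//.
  rewrite (_ : (fun _ => _) =
     (fun x => 2 ^- n * stretch 1 (fun x => `|walsh_prim M k./2 n x|) x)).
    have bn := bm_norm (bm_walsh_prim M k./2 n).
    rewrite meanZ; last exact: bm_stretch.
    rewrite mean_stretch//.
    rewrite ler_pM2l ?invr_gt0 ?exprn_gt0//.
    by have := IH1 _ nl; lra.
  apply/funext => x; rewrite normrM ger0_norm ?invr_ge0 ?exprn_ge0// /stretch.
  by case: ifP => // _; rewrite normrM e1.
have H2 n : (0 < n <= size l')%N -> forall x, `|walsh_prim M.+1 k n x| <=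
    2 * 2 ^- weight (take n (exponents M.+1 k)).
  move=> /andP[n0 nl] x; rewrite KE// cE// normrM ger0_norm ?invr_ge0 ?exprn_ge0//.
  rewrite mulrCA ler_pM2l ?invr_gt0 ?exprn_gt0// /stretch.
  by case: ifP => _; rewrite ?normrM ?e1 ?mul1r; apply: IH2; rewrite n0.
(* A lowest digit 0 leaves the number of available primitives unchanged; a lowest digit 1 adds
   one. *)
have [ok|ek] := boolP (odd k); last first.
  have sl' : size (exponents M.+1 k) = size l' by rewrite sl (negbTE ek) addn0.
  rewrite sl'; split => //.
  - move=> n nl; rewrite KE ?(ltnW nl)// meanZ; last exact/bm_stretch/bm_walsh_prim.
    by rewrite mean_stretch ?IH0 ?mulr0//; exact: bm_walsh_prim.
  - move=> x; rewrite KE// (negbTE ek) mulr_ge0 ?invr_ge0 ?exprn_ge0// /stretch.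
    by case: ifP => // _; rewrite expr0 mul1r.
have sl' : size (exponents M.+1 k) = (size l').+1 by rewrite sl ok addn1.
set n' := size l' in sl' *.
pose g := walsh_prim M k./2 n'.
have bg : bounded_measurable g by exact: bm_walsh_prim.
have KE' : walsh_prim M.+1 k n'.+1 =
    fun x => 2 ^- n' * prim (stretch (-1) g) x.
  rewrite {1}/walsh_prim iterS -/(walsh_prim M.+1 k n') KE//.
  by rewrite primZ; [rewrite ok expr1|exact/bm_stretch/bm_walsh_prim].
have K0 x : 0 <= walsh_prim M.+1 k n'.+1 x.
  rewrite KE' mulr_ge0 ?invr_ge0 ?exprn_ge0// prim_stretch//.
  by have := @le_prim g (2 * x - 1) (2 * x) bg IH3; lra.
(* The new exponent 0 has weight 2, hence the two factors 1/2; raising the other n' exponents by one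
   gives 2^-n'. *)
have cE' : (2 ^- weight (take n'.+1 (exponents M.+1 k)) : R) =
    2 ^- n' * (2^-1 * (2^-1 * 2 ^- weight (take n' l'))).
  rewrite exponentsS ok take_oversize; last first.
    by rewrite size_cat size_map addn1.
  rewrite weight_cat weight_mapS take_size /weight big_seq1 add0n.
  rewrite !exprD expr2 !invfM; ring.
have g0 : mean g <= 2 ^- weight (take n' l').
  apply: le_trans (IH1 n' (leqnn _)); apply: le_mean => //; first exact: bm_norm.
  by move=> t _; exact: ler_norm.
rewrite sl'; split => //.
- move=> n; rewrite ltnS => nl; rewrite KE// meanZ; last exact/bm_stretch/bm_walsh_prim.
  by rewrite mean_stretch ?ok ?expr1 ?subrr ?mul0r ?mulr0//; exact: bm_walsh_prim.
- move=> n; rewrite leq_eqVlt => /predU1P[->|/H1//].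
  rewrite (_ : (fun _ => _) = walsh_prim M.+1 k n'.+1); last first.
    by apply/funext => x; rewrite ger0_norm.
  rewrite KE' meanZ; last exact/bm_prim/bm_stretch.
  rewrite mean_prim_odd// cE' ler_pM2l ?invr_gt0 ?exprn_gt0//.
  by lra.
- move=> n /andP[n0]; rewrite leq_eqVlt => /predU1P[-> x|nl]; last by apply: H2; rewrite n0.
  rewrite ger0_norm// KE' cE' mulrCA ler_pM2l ?invr_gt0 ?exprn_gt0// prim_stretch//.
  have := @prim_ge0 g (2 * x - 1) IH3; have := @prim_le g (2 * x) bg IH3.
  by lra.
Qed.

End walsh.

(** * Integrals over the cube as iterated means *)

Section tonelli_sigma_finite.
Context d1 d2 (T1 : measurableType d1) (T2 : measurableType d2) (R : realType).
Variables (mu : {measure set T2 -> \bar R}) (smu : sigma_finite setT mu).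

(** [lebesgue_tuple] is a recursively defined measure whose sigma-finiteness is a separate
    proposition. The copy takes that proposition as an argument, so that it can carry the structure
    required by Tonelli's theorem. *)
Definition sigma_finite_copy of sigma_finite setT mu : set T2 -> \bar R := mu.
HB.instance Definition _ := Measure.copy (sigma_finite_copy smu) mu.
HB.instance Definition _ :=
  Measure_isSigmaFinite.Build _ _ _ (sigma_finite_copy smu) smu.

Lemma sigma_finite_tonelli (m1 : {sigma_finite_measure set T1 -> \bar R})
    (f : T1 * T2 -> \bar R) :
  measurable_fun setT f -> (forall z, (0 <= f z)%E) ->
  (\int[(m1 \x^ mu)%E]_z f z = \int[mu]_y \int[m1]_x f (x, y))%E.
Proof.
move=> mf f0; have := @fubini_tonelli2 _ _ _ _ _ m1 (sigma_finite_copy smu) f mf f0.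
rewrite /fubini_G => <-; apply: eq_measure_integral => A mA _.
(* The product measure [\x^] is built from the sections in the other variable; its values on
   rectangles identify it with the one in Tonelli's theorem. *)
apply/esym/(@product_measure_unique _ _ _ _ _ m1 (sigma_finite_copy smu)) => // B C mB mC.
exact: product_measure2E.
Qed.

End tonelli_sigma_finite.

Section lebesgue_tuple.
Context (R : realType).
Local Notation lam := (@lebesgue_measure R).
Local Notation RR := (measurableTypeR R).
Local Notation lamT := (lebesgue_tuple R).

Lemma measurable_box n (I : set RR) : measurable I ->
  measurable [set t : n.-tuple RR | forall i, I (tnth t i)].
Proof.
move=> mI; rewrite (_ : [set _ | _] =
    \bigcap_(i in [set: 'I_n]) ((@tnth n RR ^~ i) @^-1` I)).
  apply: fin_bigcap_measurable => // i _; rewrite -[X in measurable X]setTI.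
  exact: measurable_tnth.
by apply/seteqP; split => t /= H i; [move=> _; exact: H|exact: H].
Qed.

Lemma box_cons n (I : set RR) :
  @cons_pair R n @^-1` [set t | forall i, I (tnth t i)] =
  I `*` [set t | forall i, I (tnth t i)].
Proof.
apply/seteqP; split=> [[x t]|[x t] [Ix It]] /=.
  move=> H; split; first by have := H ord0; rewrite (tnth_nth x).
  move=> i; have := H (lift ord0 i).
  by rewrite (tnth_nth x)/= -tnth_nth.
move=> i; rewrite (tnth_nth x)/=; case: (unliftP ord0 i) => [j ->|->] //=.
by rewrite -tnth_nth.
Qed.

Lemma lebesgue_tuple_box n (I : set RR) : measurable I ->
  lamT n [set t | forall i, I (tnth t i)] = (\prod_(i < n) lam I)%E.
Proof.
move=> mI; elim: n => [|n IH].
  rewrite big_ord0 /= diracE mem_set//= => -[]//.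
rewrite big_ord_recl -IH /= /lebesgue_cons /pushforward box_cons.
by rewrite product_measure2E//; exact: measurable_box.
Qed.

Lemma sigma_finite_lebesgue_tuple n : sigma_finite setT (lamT n).
Proof.
exists (fun k => [set t | forall i, (`[- k%:R, k%:R]%classic : set RR) (tnth t i)]).
  apply/seteqP; split => // t _.
  pose B := \sum_(i < n) `|tnth t i : R|.
  have B0 : 0 <= B by exact: sumr_ge0.
  exists (Num.truncn B).+1 => // i; rewrite /= in_itv/= -ler_norml.
  apply: (le_trans _ (ltW (truncnS_gt B))).
  by rewrite /B (bigD1 i)//= lerDl sumr_ge0.
move=> k; split; first by apply: measurable_box; exact: measurable_itv.
rewrite lebesgue_tuple_box//.
have [] : (0 <= \prod_(i < n) lam `[(- k%:R)%R, k%:R])%E /\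
    (\prod_(i < n) lam `[(- k%:R)%R, k%:R] < +oo)%E; last by [].
elim/big_ind : _ => [|x y [x0 xoo] [y0 yoo]|i _].
- by rewrite lee_fin ltry.
- by rewrite mule_ge0// lte_mul_pinfty// ge0_fin_numE.
- by rewrite measure_ge0 lebesgue_measure_itv; case: ifP => _; rewrite ltry.
Qed.

Lemma measurable_cube n : measurable (@cubeT R n).
Proof.
rewrite (_ : @cubeT R n =
  [set t | forall i, (`[0, 1[%classic : set RR) (tnth t i)]).
  by apply: measurable_box; exact: measurable_itv.
by apply/seteqP; split => t /= H i; have := H i; rewrite /= in_itv.
Qed.

Lemma lebesgue_tuple_cube n : lamT n (@cubeT R n) = 1%E.
Proof.
rewrite (_ : @cubeT R n =
  [set t | forall i, (`[0, 1[%classic : set RR) (tnth t i)]).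
  rewrite lebesgue_tuple_box; last exact: measurable_itv.
  by rewrite big1// => i _; exact: lebesgue_unit.
by apply/seteqP; split => t /= H i; have := H i; rewrite /= in_itv.
Qed.

(** The head of the tuple becomes the innermost variable; [averages] likewise treats the head of its
    list first. *)
Lemma integral_cube_cons n (F : n.+1.-tuple RR -> \bar R) :
  measurable_fun setT F -> (forall t, (0 <= F t)%E) ->
  (\int[lamT n.+1]_(t in @cubeT R n.+1) F t =
   \int[lamT n]_(u in @cubeT R n) \int[lam]_(x in `[0%R, 1%R[)
     F [the n.+1.-tuple RR of x :: u])%E.
Proof.
move=> mF F0.
pose G := fun z : RR * n.-tuple RR => (F \_ (@cubeT R n.+1)) (cons_pair z).
have mcons := @measurable_cons_pair R n.
have mFc : measurable_fun setT (F \_ (@cubeT R n.+1)).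
  by apply/(measurable_restrictT _ (@measurable_cube n.+1)); exact: measurable_funTS.
have F0c z : (0 <= (F \_ (@cubeT R n.+1)) z)%E by apply: erestrict_ge0.
have mG : measurable_fun setT G by exact: (measurableT_comp mFc mcons).
have G0 z : (0 <= G z)%E by exact: F0c.
transitivity (\int[(lam \x^ lamT n)%E]_z G z)%E.
  rewrite integral_mkcond /=.
  by rewrite (@ge0_integral_pushforward _ _ _ _ _ _ mcons).
rewrite sigma_finite_tonelli//; last exact: sigma_finite_lebesgue_tuple.
rewrite [RHS]integral_mkcond; apply: eq_integral => u _.
rewrite patchE; case: ifPn => uC; last first.
  rewrite (eq_integral (cst 0%E)) ?integral0// => x _.
  rewrite /G patchE ifF//; apply/negbTE; apply: contra uC => /set_mem H.
  apply/mem_set => i; have := H (lift ord0 i).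
  by rewrite (tnth_nth x)/= -tnth_nth.
rewrite [RHS]integral_mkcond; apply: eq_integral => x _.
rewrite /G !patchE; congr (if _ then _ else _).
apply/idP/idP => /set_mem H; apply/mem_set.
  by have := H ord0; rewrite (tnth_nth x)/= in_itv.
move=> i; rewrite (tnth_nth x)/=; case: (unliftP ord0 i) => [j ->|->] //=.
by move: uC => /set_mem /(_ j); rewrite (tnth_nth x).
Qed.
End lebesgue_tuple.

(* Measurability is required along every family of measurable coordinates, so
   that it is stable under partial integration and can be read both on R x R
   and on tuples. *)
Definition tame (R : realType) (s : nat) (G : 'rV[R]_s -> R) : Prop :=
  (exists B, forall x, `|G x| <= B) /\
  forall d (T : measurableType d) (c : 'I_s -> T -> R),
    (forall i, measurable_fun setT (c i)) ->
    measurable_fun setT (fun z => G (\row_i c i z)).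

Definition update (R : realType) (s : nat) (x : 'rV[R]_s) (i : 'I_s) (t : R) :
    'rV[R]_s := \row_j (if j == i then t else x 0 j).

Definition updates (R : realType) (s : nat) (x : 'rV[R]_s) (w : seq 'I_s)
    (ts : seq R) : 'rV[R]_s :=
  \row_j (if j \in w then nth 0 ts (index j w) else x 0 j).

(** The result is still a function of all the variables, constant in the i-th one. Averages over
    different variables can thus be composed and permuted without a change of type. *)
Definition average (R : realType) (s : nat) (i : 'I_s) (G : 'rV[R]_s -> R)
    (x : 'rV[R]_s) : R := mean (fun t => G (update x i t)).

Definition averages (R : realType) (s : nat) (w : seq 'I_s)
    (G : 'rV[R]_s -> R) : 'rV[R]_s -> R :=
  foldl (fun G i => average i G) G w.

Section tame.
Context (R : realType) (s : nat).
Implicit Types (G H : 'rV[R]_s -> R) (x y : 'rV[R]_s) (i j : 'I_s) (w : seq 'I_s).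

Lemma tame_bm G d (T : measurableType d) (c : 'I_s -> T -> R) :
  tame G -> (forall i, measurable_fun setT (c i)) ->
  bounded_measurable (fun z => G (\row_i c i z)).
Proof. by move=> [[B hB] mG] mc; split; [exact: mG|exists B => z]. Qed.

Lemma tameM G H : tame G -> tame H -> tame (fun x => G x * H x).
Proof.
move=> tG tH; have [[B hB] _] := tG; have [[B' hB'] _] := tH; split.
  by exists (B * B') => x; rewrite normrM; exact: ler_pM.
by move=> d T c mc; case: (bmM (tame_bm tG mc) (tame_bm tH mc)).
Qed.

Lemma tameD G H : tame G -> tame H -> tame (fun x => G x + H x).
Proof.
move=> tG tH; have [[B hB] _] := tG; have [[B' hB'] _] := tH; split.
  by exists (B + B') => x; exact: le_trans (ler_normD _ _) (lerD _ _).
by move=> d T c mc; case: (bmD (tame_bm tG mc) (tame_bm tH mc)).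
Qed.

Lemma tame_cst (c : R) : tame (fun _ : 'rV[R]_s => c).
Proof. by split; [exists (`|c|)|move=> *; exact: measurable_cst]. Qed.

Lemma tameZ c G : tame G -> tame (fun x => c * G x).
Proof. by move=> tG; apply: tameM => //; exact: tame_cst. Qed.

Lemma tameB G H : tame G -> tame H -> tame (fun x => G x - H x).
Proof.
move=> tG tH; under eq_fun do rewrite -mulN1r.
by apply: tameD => //; exact: tameZ.
Qed.

Lemma tame_norm G : tame G -> tame (fun x => `|G x|).
Proof.
move=> tG; have [[B hB] _] := tG; split; first by exists B => x; rewrite normr_id.
by move=> d T c mc; case: (bm_norm (tame_bm tG mc)).
Qed.

Lemma tame_coord (g : R -> R) i : bounded_measurable g ->
  tame (fun x => g (x 0 i)).
Proof.
move=> [mg [B hB]]; split; first by exists B.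
move=> d T c mc; rewrite (_ : (fun _ => _) = g \o c i); first exact: measurableT_comp.
by apply/funext => z /=; rewrite mxE.
Qed.

Lemma tame_prod (I : Type) (r : seq I) (G : I -> 'rV[R]_s -> R) :
  (forall k, tame (G k)) -> tame (fun x => \prod_(k <- r) G k x).
Proof.
move=> tG; elim: r => [|k r IH].
  by under eq_fun do rewrite big_nil; exact: tame_cst.
by under eq_fun do rewrite big_cons; exact: tameM.
Qed.

Lemma tame_sum (I : Type) (r : seq I) (G : I -> 'rV[R]_s -> R) :
  (forall k, tame (G k)) -> tame (fun x => \sum_(k <- r) G k x).
Proof.
move=> tG; elim: r => [|k r IH].
  by under eq_fun do rewrite big_nil; exact: tame_cst.
by under eq_fun do rewrite big_cons; exact: tameD.
Qed.

Lemma tame_update G x i : tame G ->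
  bounded_measurable (fun t => G (update x i t)).
Proof.
move=> tG; apply: (@tame_bm G _ R (fun j t => if j == i then t else x 0 j)) => // j.
by case: (j == i).
Qed.

Lemma tame_average i G : tame G -> tame (average i G).
Proof.
move=> tG; have [[B hB] _] := tG; split.
  by exists B => x; apply: mean_norm_le => //; exact: tame_update.
move=> d T c mc.
have bG : bounded_measurable (fun zt : T * R =>
    G (\row_j (if j == i then zt.2 else c j zt.1))).
  apply: (tame_bm (c := fun j (zt : T * R) => if j == i then zt.2 else c j zt.1)) => // j.
  by case: (j == i) => //; apply: measurableT_comp.
have [mm _] := bm_mean bG.
rewrite (_ : (fun _ => _) =
  (fun z => mean (fun t => G (\row_j (if j == i then t else c j z)))))//.
apply/funext => z; apply: eq_mean => t _; congr G.
by apply/rowP => j; rewrite !mxE.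
Qed.

Lemma tame_averages w G : tame G -> tame (averages w G).
Proof. by elim: w G => [//|i w IH] G tG /=; exact/IH/tame_average. Qed.

Lemma averageC i j G : tame G -> average i (average j G) = average j (average i G).
Proof.
move=> tG; apply/funext => x; rewrite /average.
have [->//|ij] := eqVneq i j.
pose H := fun ab : R * R =>
  G (\row_k (if k == j then ab.2 else if k == i then ab.1 else x 0 k)).
have bH : bounded_measurable H.
  apply: (tame_bm (c := fun k (ab : R * R) =>
    if k == j then ab.2 else if k == i then ab.1 else x 0 k)) => // k.
  case: (k == j); first exact: measurable_snd.
  by case: (k == i); [exact: measurable_fst|exact: measurable_cst].
transitivity (mean (fun a => mean (fun b => H (a, b)))).
  apply: eq_mean => a _; apply: eq_mean => b _; congr G.
  by apply/rowP => k; rewrite !mxE.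
rewrite (mean_swap bH).
apply: eq_mean => b _; apply: eq_mean => a _; congr G.
apply/rowP => k; rewrite !mxE; case: (eqVneq k j) => [->|//].
by rewrite eq_sym (negbTE ij).
Qed.

Lemma averages_cat w w' G : averages (w ++ w') G = averages w' (averages w G).
Proof. exact: foldl_cat. Qed.

Lemma average_averages i w G : tame G ->
  average i (averages w G) = averages w (average i G).
Proof.
elim: w G => [//|j w IH] G tG /=.
rewrite IH; last exact: tame_average.
by rewrite (averageC i j tG).
Qed.

Lemma averages_comm w w' G : tame G ->
  averages w (averages w' G) = averages w' (averages w G).
Proof.
elim: w G => [//|j w IH] G tG /=.
rewrite average_averages// IH//; exact: tame_average.
Qed.

Lemma perm_averages w w' G : tame G -> perm_eq w w' ->
  averages w G = averages w' G.
Proof.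
move=> tG pw.
apply: (@catCA_perm_ind _ (fun l => averages w G = averages l G) _ _ _ pw) => //.
move=> s1 s2 s3 ->; rewrite !averages_cat; congr (averages s3 _).
exact: averages_comm.
Qed.

Lemma le_averages w G H x : tame G -> tame H ->
  (forall y, (forall j, j \in w -> 0 <= y 0 j < 1) ->
     (forall j, j \notin w -> y 0 j = x 0 j) -> G y <= H y) ->
  averages w G x <= averages w H x.
Proof.
elim: w G H => [|i w IH] G H tG tH GH /=; first by apply: GH => // j.
apply: IH; [exact: tame_average..|].
move=> y yw yx; apply: le_mean; [exact: tame_update..|].
move=> t t01; apply: GH => j; rewrite inE mxE.
  by case: (eqVneq j i) => //= _; exact: yw.
by case: (eqVneq j i) => //= _; exact: yx.
Qed.

Lemma eq_averages w G H x :
  (forall y, (forall j, j \in w -> 0 <= y 0 j < 1) ->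
     (forall j, j \notin w -> y 0 j = x 0 j) -> G y = H y) ->
  averages w G x = averages w H x.
Proof.
elim: w G H => [|i w IH] G H GH /=; first by apply: GH => // j.
apply: IH => y yw yx; apply: eq_mean => t t01; apply: GH => j; rewrite inE mxE.
  by case: (eqVneq j i) => //= _; exact: yw.
by case: (eqVneq j i) => //= _; exact: yx.
Qed.

Lemma averagesD w G H : tame G -> tame H ->
  averages w (fun x => G x + H x) = fun x => averages w G x + averages w H x.
Proof.
elim: w G H => [//|i w IH] G H tG tH /=.
rewrite -IH; [|exact: tame_average..]; congr (averages w _).
by apply/funext => x; apply: meanD; exact: tame_update.
Qed.

Lemma averagesZ w (c : R) G : tame G ->
  averages w (fun x => c * G x) = fun x => c * averages w G x.
Proof.
elim: w G => [//|i w IH] G tG /=.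
rewrite -IH; [|exact: tame_average]; congr (averages w _).
by apply/funext => x; apply: meanZ; exact: tame_update.
Qed.

Lemma averagesB w G H : tame G -> tame H ->
  averages w (fun x => G x - H x) = fun x => averages w G x - averages w H x.
Proof.
move=> tG tH; under eq_fun do rewrite -mulN1r.
rewrite averagesD//; last exact: tameZ.
by apply/funext => x; rewrite averagesZ// mulN1r.
Qed.

Lemma averages_cst w (c : R) : averages w (fun=> c) = fun _ : 'rV[R]_s => c.
Proof.
elim: w => [//|i w IH] /=; rewrite -[RHS]IH; congr (averages w _).
by apply/funext => x; exact: mean_cst.
Qed.

Lemma averages_sum (I : Type) (r : seq I) w (G : I -> 'rV[R]_s -> R) :
  (forall k, tame (G k)) ->
  averages w (fun x => \sum_(k <- r) G k x) = fun x => \sum_(k <- r) averages w (G k) x.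
Proof.
move=> tG; elim: r => [|k r IH].
  under eq_fun do rewrite big_nil; rewrite averages_cst.
  by apply/funext => x; rewrite big_nil.
under eq_fun do rewrite big_cons.
rewrite averagesD//; last exact: tame_sum.
by apply/funext => x; rewrite IH big_cons.
Qed.

Lemma ler_norm_averages w G x : tame G ->
  `|averages w G x| <= averages w (fun y => `|G y|) x.
Proof.
move=> tG; rewrite ler_norml; apply/andP; split.
  have := @le_averages w (fun y => (-1) * `|G y|) G x (tameZ _ (tame_norm tG)) tG.
  rewrite averagesZ; last exact: tame_norm.
  by rewrite mulN1r; apply => y _ _; rewrite mulN1r lerNnormlW.
by apply: le_averages => //; [exact: tame_norm|move=> y _ _; exact: ler_norm].
Qed.

Lemma averages_coord w (g : 'I_s -> R -> R) x :
  uniq w -> (forall i, bounded_measurable (g i)) ->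
  averages w (fun x => \prod_(i <- w) g i (x 0 i)) x = \prod_(i <- w) mean (g i).
Proof.
move=> + bg; elim: w => [|i w IH] /=; first by rewrite !big_nil.
move=> /andP[iw uw]; rewrite big_cons -IH//.
have tp : tame (fun y : 'rV[R]_s => \prod_(j <- w) g j (y 0 j)).
  by apply: tame_prod => k; exact: tame_coord.
rewrite -[RHS]/((fun x => mean (g i) * averages w _ x) x) -averagesZ//.
congr (averages w _ x); apply/funext => y.
rewrite /average mulrC -meanZ//; apply: eq_mean => t _.
rewrite big_cons mxE eqxx mulrC; congr (_ * _); apply: eq_big_seq => j jw.
by rewrite mxE; case: eqVneq jw iw => // -> ->.
Qed.

End tame.

(** * Iterated means as integrals over the cube of tuples *)

Section tuple_averages.
Context (R : realType) (s : nat).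
Implicit Types (G : 'rV[R]_s -> R) (x : 'rV[R]_s) (w : seq 'I_s).
Local Notation RR := (measurableTypeR R).
Local Notation lamT := (lebesgue_tuple R).

Lemma updates_cons x i w (t : R) (ts : seq R) :
  updates x (i :: w) (t :: ts) = update (updates x w ts) i t.
Proof.
apply/rowP => j; rewrite !mxE inE /= eq_sym.
by case: eqVneq.
Qed.

Lemma bm_updates G x w n : tame G ->
  bounded_measurable (fun t : n.-tuple RR => G (updates x w t)).
Proof.
move=> tG.
apply: (@tame_bm R s G _ (n.-tuple RR) (fun j (t : n.-tuple RR) =>
   if j \in w then nth 0 t (index j w) else x 0 j)) => // j.
case: (j \in w) => //.
have [jn|nj] := ltnP (index j w) n.
  rewrite (_ : (fun _ => _) = (fun t => tnth t (Ordinal jn))).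
    exact: (@measurable_tnth _ RR).
  by apply/funext => t; rewrite (tnth_nth 0).
rewrite (_ : (fun _ => _) = fun=> 0)//.
by apply/funext => t; rewrite nth_default ?size_tuple.
Qed.

Let integral_ge0_averages n w G x : tame G -> (forall y, 0 <= G y) -> size w = n ->
  (\int[lamT n]_(t in @cubeT R n) (G (updates x w t))%:E = (averages w G x)%:E)%E.
Proof.
elim: n w G => [|n IH] w G tG G0.
  move=> /size0nil ->; rewrite integral_dirac//; last 2 first.
    exact: measurable_cube.
    apply: measurable_funTS; apply/measurable_EFinP.
    by case: (@bm_updates G x [::] 0 tG).
  rewrite diracE mem_set ?mul1e; last by move=> -[].
  by congr (G _)%:E; apply/rowP => j; rewrite mxE.
case: w => [//|i w] [sw]; rewrite integral_cube_cons; last 2 first.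
- by apply/measurable_EFinP; case: (@bm_updates G x (i :: w) n.+1 tG).
- by move=> t; rewrite lee_fin.
rewrite [averages _ _]/= -(IH w (average i G) (tame_average i tG) _ sw); last first.
  by move=> y; apply: mean_ge0.
apply: eq_integral => u _; rewrite -meanE; last exact: tame_update.
by apply: eq_integral => t _; rewrite updates_cons.
Qed.

Lemma integral_averages n w G x : tame G -> size w = n ->
  (\int[lamT n]_(t in @cubeT R n) (G (updates x w t))%:E = (averages w G x)%:E)%E.
Proof.
move=> tG sw; have [[B hB] _] := tG.
(* Adding the bound [B] makes the function nonnegative; since the cube has measure 1, the same
   constant is subtracted on both sides afterwards. *)
have := @integral_ge0_averages n w (fun y => G y + B) x (tameD tG (tame_cst _ _)) _ sw.
rewrite averagesD//; last exact: tame_cst.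
rewrite averages_cst => H.
have mC := @measurable_cube R n.
have fC : (lamT n (@cubeT R n) < +oo)%E by rewrite lebesgue_tuple_cube ltry.
have i1 : (lamT n).-integrable (@cubeT R n) (fun t => (G (updates x w t))%:E).
  exact: (bm_integrable mC fC (bm_updates x w n tG)).
have i2 : (lamT n).-integrable (@cubeT R n) (fun t => (B)%:E).
  exact: (bm_integrable mC fC (bm_cst _ _)).
have GB y : 0 <= G y + B by move: (hB y); rewrite ler_norml => /andP[]; lra.
move: (H GB); under eq_integral do rewrite EFinD.
rewrite integralD// integral_cst//= lebesgue_tuple_cube mule1 EFinD.
by move/(congr1 (fun z => z - B%:E)%E); rewrite !addeK.
Qed.

End tuple_averages.

(** * Functions continuous on the closed cube *)

(** The coordinatewise projection on the closed cube. It is 1-Lipschitz, so composing with it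
    extends a function continuous on the cube to a bounded continuous function of the whole
    space. *)
Definition clamp (R : realType) (s : nat) (x : 'rV[R]_s) : 'rV[R]_s :=
  \row_i Order.max 0 (Order.min 1 (x 0 i)).

Section clamp.
Context (R : realType) (s : nat).
Implicit Types (F : 'rV[R]_s -> R) (x y : 'rV[R]_s).

Lemma closed_cube_clamp x : closed_cube (clamp x).
Proof.
move=> i; rewrite mxE le_max lexx/= ge_max ler01 ge_min lexx//.
Qed.

Lemma clamp_id x : closed_cube x -> clamp x = x.
Proof.
move=> xc; apply/rowP => i; rewrite mxE; have /andP[x0 x1] := xc i.
by rewrite (min_idPr _)// (max_idPr _).
Qed.

Lemma ler_dist_clamp x y i : `|clamp x 0 i - clamp y 0 i| <= `|x 0 i - y 0 i|.
Proof.
rewrite !mxE; move: (x 0 i) (y 0 i) => a b.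
rewrite !maxEle !minEle.
by case: (leP 1 a) => a1; case: (leP 1 b) => b1; rewrite ?ler01;
  case: (leP 0 a) => a0; case: (leP 0 b) => b0; rewrite ler_norml;
  case: (ger0P (a - b)) => ab; apply/andP; split; lra.
Qed.

Lemma nbhs_rowP x (P : set 'rV[R]_s) :
  nbhs x P <-> exists2 e : R, 0 < e &
    forall y, (forall i, `|x 0 i - y 0 i| < e) -> P y.
Proof.
split=> [/nbhs_ballP[e /= e0 eP]|[e e0 eP]].
  exists e => // y xy; apply: eP; split => // i j.
  by rewrite (ord1 i); exact: xy.
apply/nbhs_ballP; exists e => //= y [_ xy]; apply: eP => i.
exact: (xy 0 i).
Qed.

Lemma clamp_continuous F : {within @closed_cube R s, continuous F} ->
  forall x e, 0 < e -> exists2 d, 0 < d &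
    forall y, (forall i, `|x 0 i - y 0 i| < d) -> `|F (clamp x) - F (clamp y)| < e.
Proof.
move=> /subspace_continuousP cF x e e0.
have /cvgrPdist_lt/(_ e e0) := cF _ (closed_cube_clamp x).
rewrite /prop_near1 /within /= => /nbhs_rowP[d d0 dP].
exists d => // y xy; apply: dP => [i|]; last exact: closed_cube_clamp.
exact: le_lt_trans (ler_dist_clamp x y i) (xy i).
Qed.

Lemma clamp_bounded F : {within @closed_cube R s, continuous F} ->
  exists B, forall x, `|F (clamp x)| <= B.
Proof.
move=> cF; have cK : compact (@closed_cube R s).
  have := @rV_compact R s (fun=> `[0, 1]%classic) (fun=> @segment_compact R 0 1).
  congr compact; apply/seteqP; split => x /= H i; have := H i; by rewrite in_itv.
have /compact_bounded[M [_ MB]] := continuous_compact cF cK.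
exists (M + 1) => x; apply: (MB (M + 1)); first by rewrite ltrDl.
by exists (clamp x) => //; exact: closed_cube_clamp.
Qed.

(* Rounding every coordinate down to a grid gives functions with finitely many
   values, which converge pointwise by continuity. *)
Lemma tame_clamp F : {within @closed_cube R s, continuous F} ->
  tame (F \o @clamp R s).
Proof.
move=> cF; split; first exact: clamp_bounded.
move=> d T c mc.
pose u i z : R := Order.max 0 (Order.min 1 (c i z)).
have u01 i z : 0 <= u i z <= 1.
  by have := closed_cube_clamp (\row_j c j z) i; rewrite !mxE.
have mu i : measurable_fun setT (u i).
  by apply: measurable_maxr => //; apply: measurable_minr.
(* Indicator of the cell k_i <= (M+1) u_i < k_i + 1. The indices run up to M+1 in order to include
   u_i = 1. *)
pose cell M (k : {ffun 'I_s -> 'I_M.+2}) z : R := \prod_i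
  (if M.+1%:R * u i z < (k i)%:R then 0
   else if M.+1%:R * u i z < (k i).+1%:R then 1 else 0).
pose node M (k : {ffun 'I_s -> 'I_M.+2}) : 'rV[R]_s := \row_i ((k i)%:R / M.+1%:R).
pose step M z := \sum_k F (clamp (node M k)) * cell M k z.
have mstep M : measurable_fun setT (step M).
  apply: measurable_sum => k; apply: measurable_funM => //.
  apply: measurable_prod => i _; apply: measurable_if_lt => //.
    by apply: measurable_funM.
  by apply: measurable_if_lt => //; apply: measurable_funM.
apply/measurable_EFinP.
apply: (emeasurable_fun_cvg (fun M => EFin \o step M)).
  by move=> M; exact/measurable_EFinP.
move=> z _ /=; apply: cvg_EFin; first by apply: nearW => M.
apply/cvgrPdist_lt => e e0.
have [dl dl0 dP] := clamp_continuous cF (\row_i u i z) e0.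
near=> M.
pose kz : {ffun 'I_s -> 'I_M.+2} := [ffun i => inord (Num.truncn (M.+1%:R * u i z))].
have kzE i : (kz i : nat) = Num.truncn (M.+1%:R * u i z).
  rewrite ffunE inordK// ltnS; have /andP[u0 u1] := u01 i z.
  rewrite truncn_le_nat//; rewrite (@le_lt_trans _ _ M.+1%:R)// ?ltr_nat//.
  by rewrite ler_piMr.
have stepE : step M z = F (clamp (node M kz)).
  rewrite /step (bigD1 kz)//= big1 ?addr0 => [|k kk].
    rewrite /cell big1 ?mulr1// => i _; rewrite kzE.
    have /andP[u0 u1] := u01 i z.
    have /andP[l1 l2] := truncn_itv (mulr_ge0 (ler0n R M.+1) u0).
    by rewrite ltNge l1 /= l2.
  have [i ki] : exists i, k i != kz i.
    apply/existsP; rewrite -negb_forall; apply: contra kk => /forallP H.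
    by apply/eqP/ffunP => i; apply/eqP.
  rewrite /cell (bigD1 i)//=; have /andP[u0 u1] := u01 i z.
  case: ltP => [|l1]; first by rewrite mul0r mulr0.
  case: ltP => [l2|]; last by rewrite mul0r mulr0.
  exfalso; move/negP: ki; apply; apply/eqP/val_inj => /=.
  by rewrite kzE; apply/esym/truncn_def; rewrite l1.
have -> : clamp (\row_i c i z) = clamp (\row_i u i z).
  have -> : \row_i u i z = clamp (\row_i c i z).
    by apply/rowP => i; rewrite !mxE.
  by rewrite [RHS]clamp_id//; exact: closed_cube_clamp.
rewrite [(_ \o _) M]stepE; apply: dP => i; rewrite !mxE kzE.
have /andP[u0 u1] := u01 i z.
have /andP[l1 l2] := truncn_itv (mulr_ge0 (ler0n R M.+1) u0).
have M0 : 0 < M.+1%:R :> R by rewrite ltr0n.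
have Md : M.+1%:R^-1 < dl by near: M; exact: near_infty_natSinv_lt (PosNum dl0).
apply: le_lt_trans Md; rewrite -(ler_pM2r M0) -[X in _ * X <= _](ger0_norm (ltW M0)) -normrM.
rewrite mulrBl mulVf ?gt_eqF// divfK ?gt_eqF// [u i z * _]mulrC.
rewrite -[(Num.truncn _).+1%:R]natr1 in l2.
rewrite ler_norml; apply/andP; split; lra.
Unshelve. all: by end_near.
Qed.

End clamp.

(** * Integration by parts in several variables *)

Section partial_by_parts.
Context (R : realType) (s : nat).
Implicit Types (F : 'rV[R]_s -> R) (x : 'rV[R]_s) (i : 'I_s) (t : R).

Lemma clamp_update x i t : 0 <= t <= 1 ->
  clamp (update x i t) = update (clamp x) i t.
Proof.
move=> /andP[t0 t1]; apply/rowP => j; rewrite !mxE; case: eqVneq => // _.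
by rewrite (min_idPr _)// (max_idPr _).
Qed.

Lemma update_shift x i t h :
  update x i t + h *: delta_mx 0 i = update x i (t + h).
Proof.
apply/rowP => j; rewrite !mxE eqxx /=.
by case: eqVneq => _ /=; rewrite ?mulr1 ?mulr0 ?addr0.
Qed.

Lemma closed_cube_update x i t : closed_cube x -> 0 <= t <= 1 ->
  closed_cube (update x i t).
Proof. by move=> xc t01 j; rewrite mxE; case: eqVneq. Qed.

Lemma continuous_coordinate F x i : {within @closed_cube R s, continuous F} ->
  continuous (fun t : R => F (clamp (update x i t))).
Proof.
move=> cF t; apply/cvgrPdist_lt => e e0.
have [d d0 dP] := clamp_continuous cF (update x i t) e0.
near=> u; apply: dP => j; rewrite !mxE; case: eqVneq => _; last by rewrite subrr normr0.
by near: u; exact: (@cvgr_dist_lt _ _ _ _ _ id).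
Unshelve. all: by end_near.
Qed.

(** Only the i-th coordinate moves, and it is interior: small increments stay in the cube, so the
    filter restricted to the cube has the same limit as the punctured neighbourhood of 0, even if
    other coordinates lie on the boundary. *)
Lemma is_derive_coordinate F x i t : has_partial i F -> 0 < t < 1 ->
  is_derive t 1 (fun u : R => F (clamp (update x i u)))
    (partial i F (clamp (update x i t))).
Proof.
move=> hF t01; have t01' : 0 <= t <= 1 by lra.
pose y := clamp (update x i t).
have yc : closed_cube y by exact: closed_cube_clamp.
have near_cube : \forall h \near (0 : R)^', 0 <= t + h <= 1.
  near=> h; have : `|h| < Order.min t (1 - t).
    by near: h; apply: dnbhs0_lt; rewrite lt_min; lra.
  by rewrite lt_min !ltr_norml; lra.
have H : (fun h => h^-1 *: (((fun u : R => F (clamp (update x i u))) \o shift t) (h *: 1)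
    - F (clamp (update x i t)))) @ (0 : R)^' --> partial i F y.
  have cq : partial_quotient i F y @ partial_increments i y --> partial i F y.
    exact: hF yc.
  have cq' : partial_quotient i F y @ (0 : R)^' --> partial i F y.
    apply: cvg_trans cq => P; rewrite /nbhs/= /partial_increments /within/=.
    rewrite /nbhs/= => HP; near=> h.
    have : closed_cube (y + h *: delta_mx 0 i) -> P (partial_quotient i F y h).
      by near: h.
    apply; rewrite /y clamp_update// update_shift.
    apply: closed_cube_update; first exact: closed_cube_clamp.
    by near: h.
  apply: cvg_trans cq'; apply: near_eq_cvg; near=> h.
  rewrite /partial_quotient /= /y clamp_update// update_shift.
  rewrite clamp_update ?(addrC _ t) /= ?[h *: 1]mulr1//.
  by near: h.
by split; [apply/cvg_ex; exists (partial i F y)|exact: cvg_lim H].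
Unshelve. all: by end_near.
Qed.

(** The common form of the integrands: the weights will be Walsh functions, their primitives, or
    dyadic kernels. [F] is read through [clamp], the weights at [x] itself. *)
Definition weighted F (g : 'I_s -> R -> R) (x : 'rV[R]_s) : R :=
  F (clamp x) * \prod_i g i (x 0 i).

Lemma tame_weighted F (g : 'I_s -> R -> R) :
  {within @closed_cube R s, continuous F} -> (forall i, bounded_measurable (g i)) ->
  tame (weighted F g).
Proof.
move=> cF bg; apply: tameM; first exact: tame_clamp.
by apply: tame_prod => i; exact: tame_coord.
Qed.

Lemma average_by_parts F i (g g' : 'I_s -> R -> R) x :
  {within @closed_cube R s, continuous F} -> has_partial i F ->
  {within @closed_cube R s, continuous (partial i F)} ->
  (forall j, bounded_measurable (g j)) -> mean (g i) = 0 ->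
  (forall j, j != i -> g' j = g j) -> g' i = prim (g i) ->
  average i (weighted F g) x = - average i (weighted (partial i F) g') x.
Proof.
move=> cF hF cF' bg gi0 g'E g'i.
pose c := \prod_(j | j != i) g j (x 0 j).
have E (G : 'rV[R]_s -> R) (k : 'I_s -> R -> R) : (forall j, j != i -> k j = g j) ->
    average i (weighted G k) x =
    mean (fun t => G (clamp (update x i t)) * k i t * c).
  move=> kE; apply: eq_mean => t _; rewrite /weighted (bigD1 i)//= mxE eqxx mulrA.
  congr (_ * _); apply: eq_bigr => j ji; rewrite kE// mxE (negbTE ji)//.
rewrite !E// g'i.
have bF (G : 'rV[R]_s -> R) : {within @closed_cube R s, continuous G} ->
    bounded_measurable (fun t => G (clamp (update x i t))).
  by move=> cG; exact: (tame_update x i (tame_clamp cG)).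
have -> : mean (fun t => F (clamp (update x i t)) * g i t * c) =
    c * mean (fun t => F (clamp (update x i t)) * g i t).
  rewrite -meanZ; last by apply: bmM => //; exact: bF.
  by apply: eq_mean => t _; rewrite mulrC.
have -> : mean (fun t => partial i F (clamp (update x i t)) * prim (g i) t * c) =
    c * mean (fun t => partial i F (clamp (update x i t)) * prim (g i) t).
  rewrite -meanZ; last by apply: bmM; [exact: bF|exact: bm_prim].
  by apply: eq_mean => t _; rewrite mulrC.
rewrite -mulrN; congr (_ * _); apply: mean_by_parts => //; [exact: bF..|].
apply: increment_mean; [exact: continuous_coordinate..|exact: bF|].
by move=> t t01; exact: is_derive_coordinate.
Qed.

(** Iterated means commute, so the i-th variable can be moved to the innermost position. *)
Lemma averages_by_parts F i (g g' : 'I_s -> R -> R) x :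
  {within @closed_cube R s, continuous F} -> has_partial i F ->
  {within @closed_cube R s, continuous (partial i F)} ->
  (forall j, bounded_measurable (g j)) -> mean (g i) = 0 ->
  (forall j, j != i -> g' j = g j) -> g' i = prim (g i) ->
  averages (enum 'I_s) (weighted F g) x =
  - averages (enum 'I_s) (weighted (partial i F) g') x.
Proof.
move=> cF hF cF' bg gi0 g'E g'i.
have bg' j : bounded_measurable (g' j).
  by have [->|/g'E ->//] := eqVneq j i; rewrite g'i; exact: bm_prim.
have tF := tame_weighted cF bg; have tF' := tame_weighted cF' bg'.
have pe : perm_eq (enum 'I_s) (i :: rem i (enum 'I_s)).
  by apply: perm_to_rem; rewrite mem_enum.
rewrite !(perm_averages _ pe)//= -mulN1r.
rewrite -[RHS]/((fun x => -1 * averages _ _ x) x) -averagesZ; last exact: tame_average.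
congr (averages _ _ x); apply/funext => y; rewrite mulN1r.
exact: average_by_parts.
Qed.

Lemma count_variables (n : 'I_s -> nat) i : count_mem i (variables n) = n i.
Proof.
rewrite /variables count_flatten sumnE !big_map (bigD1_seq i)/=; last 2 first.
- by rewrite -enumT mem_enum.
- by rewrite -enumT enum_uniq.
rewrite count_nseq /= eqxx mul1n big1 ?addn0// => j ji.
by rewrite count_nseq /= (negbTE ji).
Qed.

Let leo (i j : 'I_s) := (i <= j)%N.

Lemma pairwise_variables (n : 'I_s -> nat) : pairwise leo (variables n).
Proof.
have : pairwise leo (enum 'I_s).
  rewrite -sorted_pairwise; last by move=> i j k; exact: leq_trans.
  by have := iota_sorted 0 s; rewrite -val_enum_ord sorted_map.
rewrite /variables; elim: (enum 'I_s) => [//|i r IH] /= /andP[ir /IH pr].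
rewrite pairwise_cat pr andbT; apply/andP; split.
  apply/allrelP => j k; rewrite mem_nseq => /andP[_ /eqP ->].
  case/flattenP => l /mapP[k' k'r ->]; rewrite mem_nseq => /andP[_ /eqP ->].
  exact: (allP ir).
elim: (n i) => [//|m IHm] /=; rewrite IHm andbT.
by apply/allP => k; rewrite mem_nseq => /andP[_ /eqP ->]; exact: leqnn.
Qed.

(** The smoothness hypothesis speaks only of lists of the form [variables n]. Integration by parts
    along such a list passes through its suffixes, and these have the same form because a sorted
    list is determined by its multiplicities. *)
Lemma variables_suffix (n : 'I_s -> nat) (w w' : seq 'I_s) :
  variables n = w' ++ w -> w = variables (fun j => count_mem j w).
Proof.
move=> nE; have lt : transitive leo by move=> i j k; exact: leq_trans.
apply: (sorted_eq lt).
- by move=> i j; rewrite /leo -eqn_leq => /eqP/val_inj.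
- rewrite sorted_pairwise//; have := pairwise_variables n.
  by rewrite nE pairwise_cat => /and3P[].
- by rewrite sorted_pairwise//; exact: pairwise_variables.
- by apply/allP => i _ /=; rewrite count_variables.
Qed.

Lemma averages_partials alpha F (a : 'I_s -> nat) (g : 'I_s -> R -> R) x :
  continuous_mixed_partials alpha F -> (forall i, le_order (a i) alpha) ->
  (forall i, bounded_measurable (g i)) ->
  (forall i j, (j < a i)%N -> mean (iter j (@prim R) (g i)) = 0) ->
  averages (enum 'I_s) (weighted F g) x = (-1) ^+ size (variables a) *
    averages (enum 'I_s) (weighted (mixed_partial a F)
      (fun i => iter (a i) (@prim R) (g i))) x.
Proof.
move=> hF aalpha bg g0.
have biter i j : bounded_measurable (iter j (@prim R) (g i)).
  by elim: j => [|j IH] //=; exact: bm_prim.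
(* Generalized to the suffixes [w]: variables are consumed from the right, in the order in which
   [partials] differentiates. *)
suff H w w' : variables a = w' ++ w ->
    averages (enum 'I_s) (weighted F g) x = (-1) ^+ size w *
    averages (enum 'I_s) (weighted (partials w F)
      (fun i => iter (count_mem i w) (@prim R) (g i))) x.
  rewrite (H (variables a) [::])//; congr (_ * averages _ (weighted _ _) x).
  by apply/funext => i; rewrite count_variables.
elim: w w' => [|i w IH] w' wE; first by rewrite expr0 mul1r.
have wE' : variables a = rcons w' i ++ w by rewrite cat_rcons.
have cle (l l' : seq 'I_s) j : variables a = l' ++ l -> (count_mem j l <= a j)%N.
  by move=> lE; rewrite -(count_variables a j) lE count_cat leq_addl.
have le_orderW m m' : (m <= m')%N -> le_order m' alpha -> le_order m alpha.
  by case: alpha {hF aalpha} => //= b; exact: leq_trans.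
have [_ cw] := hF (fun j => count_mem j w) (fun j => le_orderW _ _ (cle _ _ j wE') (aalpha j)).
have [hiw ciw] := hF (fun j => count_mem j (i :: w))
  (fun j => le_orderW _ _ (cle _ _ j wE) (aalpha j)).
rewrite /mixed_partial -(variables_suffix wE') in cw.
rewrite /mixed_partial -(variables_suffix wE) in hiw ciw.
have [_ hpi] := hiw.
rewrite (IH _ wE').
rewrite (@averages_by_parts (partials w F) i _
  (fun j => iter (count_mem j (i :: w)) (@prim R) (g j)))//=.
- by rewrite exprS mulN1r mulrN mulNr.
- by apply: g0; apply: leq_trans (cle _ _ i wE); rewrite /= eqxx.
- by move=> j ji; rewrite eq_sym (negbTE ji).
- by rewrite eqxx.
Qed.

End partial_by_parts.

(** * Walsh expansions on digital nets *)

Lemma sum_double (R : nmodType) (F : nat -> R) (n : nat) :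
  \sum_(k < n.*2) F k = \sum_(k < n) (F k.*2 + F k.*2.+1).
Proof.
elim: n => [|n IH]; first by rewrite !big_ord0.
by rewrite doubleS !big_ord_recr /= IH addrA.
Qed.

Section kernel.
Context (R : realType).
Implicit Types (y : nat -> bool) (t : R).

(** The value of wal_k at the point with binary digits [y], read off the digits. *)
Definition character (M k : nat) y : R :=
  \prod_(j < M) (if bit k j && y j then -1 else 1).

Definition dyadic_value (M : nat) y : R := \sum_(j < M) (y j)%:R * 2 ^- j.+1.

(* 2 ^ M times the indicator of the dyadic interval of length 2 ^ - M with
   digits y. *)
Fixpoint kernel (M : nat) y t : R :=
  if M is M'.+1 then
    if t < 2^-1 then
      if y 0%N then 0 else 2 * kernel M' (y \o S) (2 * t)
    else if y 0%N then 2 * kernel M' (y \o S) (2 * t - 1) else 0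
  else 1.

Lemma characterS M k y : character M.+1 k y =
  (if odd k && y 0%N then -1 else 1) * character M k./2 (y \o S).
Proof.
rewrite /character big_ord_recl bit0; congr (_ * _).
by apply: eq_bigr => j _; rewrite /= bitS.
Qed.

(** This is the Walsh-Dirichlet kernel. The terms of index 2k and 2k+1 differ only by the sign
    attached to the first digits of [y] and [t]: they are equal if these digits agree and cancel
    otherwise. *)
Lemma kernelE M y t :
  kernel M y t = \sum_(k < 2 ^ M) character M k y * walsh M k t.
Proof.
elim: M y t => [|M IH] y t.
  by rewrite expn0 big_ord1 /character big_ord0 mulr1.
rewrite expnS mul2n (sum_double (fun k => character M.+1 k y * walsh M.+1 k t)).
have E (k : 'I_(2 ^ M)) : character M.+1 k.*2 y * walsh M.+1 k.*2 t +
    character M.+1 k.*2.+1 y * walsh M.+1 k.*2.+1 t =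
    (if t < 2^-1 then if y 0%N then 0 else 2 * (character M k (y \o S) * walsh M k (2 * t))
     else if y 0%N then 2 * (character M k (y \o S) * walsh M k (2 * t - 1)) else 0).
  rewrite !characterS /= !odd_double /= doubleK uphalf_double /stretch expr0 expr1.
  by case: ifP => _; case: (y 0%N); ring.
rewrite (eq_bigr _ (fun k _ => E k)) /=.
by case: ifP => _; case: (y 0%N); rewrite ?big1_eq// IH mulr_sumr.
Qed.

Lemma bm_kernel M y : bounded_measurable (kernel M y).
Proof.
rewrite (funext (kernelE M y)).
by apply: bm_sum => k; apply: bmZ; exact: bm_walsh.
Qed.

Lemma kernel_ge0 M y t : 0 <= kernel M y t.
Proof.
elim: M y t => [//|M IH] y t /=.
by case: ifP => _; case: ifP => _ //; rewrite mulr_ge0.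
Qed.

Lemma mean_kernel M y : mean (kernel M y) = 1.
Proof.
elim: M y => [|M IH] y; first exact: mean_cst.
rewrite mean_halving; last exact: bm_kernel.
have bk := bm_kernel M (y \o S).
have -> : mean (fun t => kernel M.+1 y (2^-1 * t)) =
    (if y 0%N then 0 else 2 * mean (kernel M (y \o S))).
  transitivity (mean (fun t => if y 0%N then 0 else 2 * kernel M (y \o S) t)).
    apply: eq_mean => t /andP[t0 t1] /=; rewrite ifT; last by lra.
    by rewrite mulrA divff ?mul1r// pnatr_eq0.
  by case: (y 0%N); rewrite ?mean_cst ?meanZ.
have -> : mean (fun t => kernel M.+1 y (2^-1 * t + 2^-1)) =
    (if y 0%N then 2 * mean (kernel M (y \o S)) else 0).
  transitivity (mean (fun t => if y 0%N then 2 * kernel M (y \o S) t else 0)).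
    apply: eq_mean => t /andP[t0 t1] /=; rewrite ifF; last first.
      by apply/negbTE; rewrite -leNgt; lra.
    by rewrite (_ : 2 * (2^-1 * t + 2^-1) - 1 = t)//; lra.
  by case: (y 0%N); rewrite ?mean_cst ?meanZ.
by rewrite IH; case: (y 0%N); lra.
Qed.

Lemma dyadic_valueS M y :
  dyadic_value M.+1 y = 2^-1 * ((y 0%N)%:R + dyadic_value M (y \o S)).
Proof.
rewrite /dyadic_value big_ord_recl expr1 mulrDr mulrC; congr (_ + _).
rewrite mulr_sumr; apply: eq_bigr => j _.
by rewrite [in LHS]exprS invfM mulrCA.
Qed.

Lemma kernel_support M y t : 0 <= t < 1 -> kernel M y t != 0 ->
  `|dyadic_value M y - t| <= 2 ^- M.
Proof.
elim: M y t => [|M IH] y t t01.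
  by rewrite /dyadic_value big_ord0 sub0r normrN expr0 invr1 ger0_norm; lra.
rewrite dyadic_valueS /= exprS invfM.
case: ltP => t2; case: (y 0%N); rewrite ?eqxx//= mulf_eq0 pnatr_eq0/= => k0.
- have : 0 <= 2 * t < 1 by lra.
  by move=> /IH/(_ k0); rewrite !ler_norml => /andP[? ?]; apply/andP; split; lra.
- have : 0 <= 2 * t - 1 < 1 by lra.
  by move=> /IH/(_ k0); rewrite !ler_norml => /andP[? ?]; apply/andP; split; lra.
Qed.

Lemma dyadic_value_cube M y : 0 <= dyadic_value M y <= 1.
Proof.
elim: M y => [|M IH] y; first by rewrite /dyadic_value big_ord0 lexx ler01.
by rewrite dyadic_valueS; have := IH (y \o S); case: (y 0%N) => /=; lra.
Qed.

End kernel.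

Section walsh_coefficients.
Context (R : realType) (s : nat).
Implicit Types (F : 'rV[R]_s -> R) (y : 'I_s -> nat -> bool).

(** Every variable is averaged, so the base point 0 is arbitrary. *)
Definition walsh_coefficient M F (k : 'I_s -> nat) : R :=
  averages (enum 'I_s) (weighted F (fun i => walsh M (k i))) 0.

Definition kernel_mean M F y : R :=
  averages (enum 'I_s) (weighted F (fun i => kernel M (y i))) 0.

Lemma kernel_meanE M F y : {within @closed_cube R s, continuous F} ->
  kernel_mean M F y = \sum_(k : {ffun 'I_s -> 'I_(2 ^ M)})
    (\prod_i character R M (k i) (y i)) * walsh_coefficient M F (fun i => k i).
Proof.
move=> cF; have tw k : tame (weighted F (fun i : 'I_s => walsh M (k i))).
  by apply: tame_weighted => // i; exact: bm_walsh.
transitivity (averages (enum 'I_s) (fun x => \sum_(k : {ffun 'I_s -> 'I_(2 ^ M)})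
    (\prod_i character R M (k i) (y i)) * weighted F (fun i => walsh M (k i)) x) 0).
  apply: eq_averages => x _ _; rewrite /weighted.
  under eq_bigr do rewrite kernelE.
  rewrite bigA_distr_bigA mulr_sumr; apply: eq_bigr => k _.
  by rewrite big_split/= mulrCA.
rewrite averages_sum; last by move=> k; exact: tameZ.
by apply: eq_bigr => k _; rewrite averagesZ.
Qed.

(** The product kernel is an approximate identity: nonnegative, of mean 1, supported within 2^-M of
    [x]. The hypothesis on [x] makes its digits vanish beyond place [n], so that [x] is the lower
    corner of its dyadic cube for every M >= n. *)
Lemma kernel_mean_cvg F y (x : 'rV[R]_s) (n : nat) (e : R) :
  {within @closed_cube R s, continuous F} -> 0 < e ->
  (forall M i, (n <= M)%N -> x 0 i = dyadic_value R M (y i)) ->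
  \forall M \near \oo, `|kernel_mean M F y - F x| <= e.
Proof.
move=> cF e0 xE.
have xc : closed_cube x.
  by move=> i; rewrite (xE n i (leqnn n)); exact: dyadic_value_cube.
have [d d0 dP] := clamp_continuous cF x e0.
near=> M.
have Md : 2 ^- M < d.
  near: M; have := @cvg_geometric R 1 2^-1 _.
  rewrite ger0_norm ?invr_ge0// invf_lt1// => /(_ (ltr1n _ 2)).
  move/cvgr_lt => /(_ d d0); apply: filterS => M.
  by rewrite /geometric/= mul1r exprVn.
have nM : (n <= M)%N by near: M; exact: nbhs_infty_ge.
have bk i := bm_kernel R M (y i).
pose P (z : 'rV[R]_s) := \prod_i kernel M (y i) (z 0 i).
have tP : tame P by apply: tame_prod => i; exact: tame_coord.
(* A constant is its own average against the kernel; this is applied to [F x] and to the bound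
   [e]. *)
have P1 (c : R) : averages (enum 'I_s) (fun z => c * P z) 0 = c.
  rewrite averagesZ// -[RHS]mulr1; congr (_ * _); rewrite /P.
  rewrite (@eq_averages _ _ _ _ (fun z => \prod_(i <- enum 'I_s) kernel M (y i) (z 0 i))).
    rewrite (@averages_coord _ _ (enum 'I_s) (fun i => kernel M (y i))) ?enum_uniq//.
    by rewrite big1// => i _; exact: mean_kernel.
  by move=> z _ _; rewrite big_enum.
have tF := tame_clamp cF.
rewrite /kernel_mean -[F x]P1.
rewrite -[X in `|X|]/((fun z => averages _ _ z - averages _ _ z) 0).
rewrite -averagesB; [|exact: tame_weighted|exact: tameZ].
have tD : tame (fun z => weighted F (fun i => kernel M (y i)) z - F x * P z).
  by apply: tameB; [exact: tame_weighted|exact: tameZ].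
apply: le_trans (ler_norm_averages _ _ tD) _.
rewrite -[leRHS](P1 e); apply: le_averages; [exact: tame_norm|exact: tameZ|].
move=> z zc _; rewrite /weighted -/(P z) -mulrBl normrM.
have P0 : 0 <= P z by apply: prodr_ge0 => i _; exact: kernel_ge0.
rewrite (ger0_norm P0).
have [->|Pz] := eqVneq (P z) 0; first by rewrite !mulr0.
rewrite ler_wpM2r// distrC -(clamp_id xc) ltW//; apply: dP => i.
rewrite (xE M i nM); apply: le_lt_trans Md; apply: kernel_support.
  by apply: zc; rewrite mem_enum.
by apply: contra Pz => /eqP k0; rewrite /P (bigD1 i)//= k0 mul0r.
Unshelve. all: by end_near.
Qed.

End walsh_coefficients.

(** * Orthogonality of characters over the field with two elements *)

Section orthogonality.
Context (R : realType).

(** Expansion of the product: through its binary digits, [h] runs over the subsets of the [m]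
    places. *)
Lemma sum_bits (m : nat) (u : 'I_m -> R) :
  \sum_(h < 2 ^ m) \prod_(j < m) (if bit h j then u j else 1) =
  \prod_(j < m) (1 + u j).
Proof.
elim: m u => [|m IH] u; first by rewrite expn0 big_ord1 !big_ord0.
rewrite expnS mul2n.
rewrite (sum_double (fun h => \prod_(j < m.+1) (if bit h j then u j else 1))).
rewrite big_ord_recl -IH mulr_sumr; apply: eq_bigr => h _.
rewrite !big_ord_recl !bit0 /= odd_double /= mul1r mulrDl mul1r.
by congr (_ + _ * _); apply: eq_bigr => j _; rewrite bitS /= ?doubleK ?uphalf_double.
Qed.

(** The nontrivial additive character of the field with two elements. *)
Definition sign2 (e : 'F_2) : R := if e == 0 then 1 else -1.

Lemma sign2D e e' : sign2 (e + e') = sign2 e * sign2 e'.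
Proof.
by case: e => [[|[|//]] ?]; case: e' => [[|[|//]] ?];
  rewrite /sign2 -!val_eqE /= ?mul1r ?mulr1 ?mulrNN ?mulr1.
Qed.

Lemma sign2_sum (I : Type) (r : seq I) (P : pred I) (e : I -> 'F_2) :
  sign2 (\sum_(i <- r | P i) e i) = \prod_(i <- r | P i) sign2 (e i).
Proof. by apply: big_morph => //; exact: sign2D. Qed.

Lemma sign2M (b : bool) e : sign2 (b%:R * e) = if b then sign2 e else 1.
Proof. by case: b; rewrite ?mul1r// mul0r /sign2 eqxx. Qed.

Lemma F2_nat (e : 'F_2) : nat_of_ord e = (e != 0) :> nat.
Proof. by case: e => [[|[|//]] ?]. Qed.

(** The sum factors over the coordinates of [z], and a coordinate equal to 1 contributes 1 - 1 =
    0. *)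
Lemma sum_sign2 (m : nat) (z : 'cV['F_2]_m) :
  \sum_(h < 2 ^ m) sign2 ((bits m h *m z) 0 0) = if z == 0 then 2 ^+ m else 0.
Proof.
transitivity (\prod_(j < m) (1 + sign2 (z j 0))).
  rewrite -sum_bits; apply: eq_bigr => h _; rewrite mxE sign2_sum.
  by apply: eq_bigr => j _; rewrite mxE sign2M.
case: eqP => [->|/eqP z0].
  rewrite -[in RHS](card_ord m) -prodr_const; apply: eq_bigr => j _.
  by rewrite mxE /sign2 eqxx.
have [j zj] : exists j, z j 0 != 0.
  apply/existsP; rewrite -negb_forall; apply: contra z0 => /forallP H.
  by apply/eqP/colP => j; rewrite mxE; apply/eqP.
by rewrite (bigD1 j)//= /sign2 (negbTE zj) subrr mul0r.
Qed.

End orthogonality.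

(** * Walsh series at the nodes of a digital net *)

Section digital_net.
Context (R : realType) (s n m : nat) (C : 'I_s -> 'M['F_2]_(n, m)).

(** Digits of a node, continued by zeros beyond place [n], so that the node can be read at every
    resolution M >= n. *)
Definition net_digit (h : nat) (i : 'I_s) (j : nat) : bool :=
  if insub j is Some j' then (bits m h *m (C i)^T) 0 j' != 0 else false.

Lemma net_digit_ord h i (j : 'I_n) :
  net_digit h i j = ((bits m h *m (C i)^T) 0 j != 0).
Proof. by rewrite /net_digit valK. Qed.

Lemma net_digit_ge h i j : (n <= j)%N -> net_digit h i j = false.
Proof. by move=> nj; rewrite /net_digit insubF// ltnNge nj. Qed.

Lemma digital_net_value (h : 'I_(2 ^ m)) i M : (n <= M)%N ->
  digital_net R C h 0 i = dyadic_value R M (net_digit h i).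
Proof.
move=> nM; rewrite mxE /dyadic_value.
transitivity (\sum_(j < n) (net_digit h i j)%:R * 2 ^- j.+1 : R).
  by apply: eq_bigr => j _; rewrite net_digit_ord F2_nat.
rewrite (big_ord_widen _ (fun j => (net_digit h i j)%:R * 2 ^- j.+1) nM).
rewrite big_mkcond; apply: eq_bigr => j _; case: ltnP => // nj.
by rewrite net_digit_ge// mul0r.
Qed.

(** Associativity moves the matrix from [h] to [k], which is how the dual net appears. Digits of [k]
    beyond place [n] meet zero digits of the node, so cutting them off changes nothing. *)
Lemma character_net (M k h : nat) i : (n <= M)%N ->
  character R M k (net_digit h i) =
  sign2 R ((bits m h *m ((C i)^T *m (bits n k)^T)) 0 0).
Proof.
move=> nM; rewrite mulmxA mxE sign2_sum /character.
transitivity (\prod_(j < n) (if bit k j && net_digit h i j then -1 else 1 : R)).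
  rewrite (big_ord_widen _ (fun j => if bit k j && net_digit h i j then -1 else 1) nM).
  rewrite [RHS]big_mkcond; apply: eq_bigr => j _; case: ltnP => // nj.
  by rewrite net_digit_ge// andbF.
apply: eq_bigr => j _; rewrite net_digit_ord.
have -> : (bits n k)^T j 0 = (bit k j)%:R by rewrite !mxE.
rewrite mulrC sign2M /sign2.
by case: (bit k j) => //=; case: eqP.
Qed.

Definition dualb (k : 'I_s -> nat) : bool :=
  \sum_i (C i)^T *m (bits n (k i))^T == 0.

Lemma dualP k : reflect (dual_net C k) (dualb k).
Proof. exact: eqP. Qed.

Lemma sum_characters M (k : 'I_s -> nat) : (n <= M)%N ->
  \sum_(h < 2 ^ m) \prod_i character R M (k i) (net_digit h i) =
  if dualb k then 2 ^+ m else 0.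
Proof.
move=> nM; rewrite /dualb -sum_sign2; apply: eq_bigr => h _.
rewrite mulmx_sumr summxE sign2_sum; apply: eq_bigr => i _.
exact: character_net.
Qed.

Lemma Err_le_walsh (f : 'rV[R]_s -> R) (e : R) :
  {within @closed_cube R s, continuous f} -> 0 < e ->
  exists M, `|Err f (digital_net R C)| <= e +
    \sum_(k : {ffun 'I_s -> 'I_(2 ^ M)} | dualb (fun i => k i) &&
        [exists i, k i != 0%N :> nat]) `|walsh_coefficient M f (fun i => k i)|.
Proof.
move=> cf e0.
(* There are finitely many nodes, so one resolution serves them all. *)
have H : \forall M \near \oo, forall h : 'I_(2 ^ m),
    `|kernel_mean M f (net_digit h) - f (digital_net R C h)| <= e.
  apply: filter_forall => h; apply: (@kernel_mean_cvg _ _ _ _ _ n) => //.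
  by move=> M i; exact: digital_net_value.
near \oo => M; exists M.
have HM : forall h : 'I_(2 ^ m),
    `|kernel_mean M f (net_digit h) - f (digital_net R C h)| <= e.
  by near: M; exact: H.
have nM : (n <= M)%N by near: M; exact: nbhs_infty_ge.
have N0 : 0 < (2 ^ m)%N%:R :> R by rewrite ltr0n expn_gt0.
have IE : Rintegral (lebesgue_tuple R s) (@cubeT R s) (f \o @row_of_tuple R s) =
    averages (enum 'I_s) (f \o @clamp R s) 0.
  have := @integral_averages R s s (enum 'I_s) _ 0 (tame_clamp cf) (size_enum_ord s).
  rewrite /Rintegral => /(congr1 fine) /= <-; congr fine.
  apply: eq_integral => t /set_mem tc; congr EFin => /=.
  rewrite (_ : updates _ _ _ = row_of_tuple t).
    rewrite clamp_id// => i; rewrite mxE; have /andP[t0 t1] := tc i.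
    by rewrite t0 ltW.
  apply/rowP => i; rewrite !mxE mem_enum index_enum_ord -tnth_nth.
  by rewrite (tnth_nth 0).
pose S1 := (2 ^ m)%N%:R^-1 * \sum_(h < 2 ^ m) kernel_mean M f (net_digit h).
have S1E : S1 = \sum_(k : {ffun 'I_s -> 'I_(2 ^ M)} | dualb (fun i => k i))
    walsh_coefficient M f (fun i => k i).
  rewrite /S1; under eq_bigr do rewrite kernel_meanE//.
  rewrite exchange_big /= mulr_sumr [RHS]big_mkcond; apply: eq_bigr => k _.
  rewrite -mulr_suml (sum_characters (fun i => k i) nM) natrX.
  case: ifP => _; last by rewrite mul0r mulr0.
  by rewrite mulrA mulVf ?mul1r// expf_neq0.
pose k0 : {ffun 'I_s -> 'I_(2 ^ M)} := [ffun=> Ordinal (expn_gt0 2 M)].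
have k0E : walsh_coefficient M f (fun i => k0 i) = averages (enum 'I_s) (f \o @clamp R s) 0.
  apply: eq_averages => x _ _; rewrite /weighted big1 ?mulr1// => i _.
  rewrite ffunE; have -> : nat_of_ord (Ordinal (expn_gt0 2 M)) = 0%N by [].
  by elim: (M) (x 0 i) => [//|M' IH] t; rewrite /= /stretch/= !IH mulr1; case: ifP.
have dk0 : dualb (fun i => k0 i).
  apply/eqP; rewrite big1// => i _; rewrite (_ : bits _ _ = 0) ?trmx0 ?mulmx0//.
  by apply/rowP => j; rewrite !mxE ffunE /bit div0n.
(* The index 0 belongs to the dual net and its coefficient is the integral of [f]; hence [S1] is
   this integral plus the coefficients of the nonzero indices. *)
have ErrE : Err f (digital_net R C) =
    (S1 - (2 ^ m)%N%:R^-1 * \sum_(h < 2 ^ m) f (digital_net R C h)) -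
    \sum_(k : {ffun 'I_s -> 'I_(2 ^ M)} | dualb (fun i => k i) &&
        [exists i, k i != 0%N :> nat]) walsh_coefficient M f (fun i => k i).
  rewrite /Err IE -k0E S1E (bigD1 k0)//=.
  rewrite (eq_bigl (fun k : {ffun 'I_s -> 'I_(2 ^ M)} => dualb (fun i => k i) &&
        [exists i, k i != 0%N :> nat])); first by ring.
  move=> k; congr (_ && _); rewrite -negb_forall; congr (~~ _).
  apply/eqP/forallP => [-> i|k0P]; first by rewrite ffunE.
  by apply/ffunP => i; apply/val_inj => /=; rewrite ffunE; exact/eqP.
rewrite ErrE; apply: le_trans (ler_normB _ _) _.
apply: lerD; last exact: ler_norm_sum.
rewrite -mulrBr -sumrB normrM ger0_norm ?invr_ge0 ?(ltW N0)//.
rewrite ler_pdivrMl//; apply: le_trans (ler_norm_sum _ _ _) _.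
rewrite mulr_natl -[in leRHS](card_ord (2 ^ m)) -sumr_const.
by apply: ler_sum => h _; exact: HM.
Unshelve. all: by end_near.
Qed.

End digital_net.

(** * Bounds on Walsh coefficients *)

Section hoelder_weighted.
Context d (T : measurableType d) (R : realType) (mu : {measure set T -> \bar R}).
Local Open Scope ereal_scope.

(* Only the L^1 and the sup bound of g enter: they control all its other
   norms by interpolation. *)
Lemma hoelder_interpolation (f g : T -> R) (p : \bar R) (A c : R) :
  0 < mu setT -> 1 <= p -> measurable_fun setT f -> measurable_fun setT g ->
  (0 < A)%R -> (0 < c)%R -> (forall x, (`|g x| <= A * c)%R) ->
  \int[mu]_x `|(g x)%:E| <= c%:E ->
  \int[mu]_x `|(f x * g x)%:E| <=
    Lnorm mu p (EFin \o f) * (A `^ fine p^-1 * c)%:E.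
Proof.
move=> mu0 p1 mf mg A0 c0 gA gc.
have mfE : measurable_fun setT (fun x => `|(f x)%:E|).
  by do 2 apply: measurableT_comp => //.
have mgE : measurable_fun setT (fun x => `|(g x)%:E|).
  by do 2 apply: measurableT_comp => //.
have mfgE : measurable_fun setT (fun x => `|(f x * g x)%:E|).
  by do 2 apply: measurableT_comp => //; exact: measurable_funM.
have A0' := ltW A0; have c0' := ltW c0.
case: p p1 => [p p1| _ |//].
- rewrite lee_fin in p1; rewrite inver gt_eqF ?(lt_le_trans ltr01)//=.
  (* For p = 1 the conjugate exponent is infinite, and the sup bound of [g] alone gives the factor A
     c. *)
  move: p1; rewrite le_eqVlt => /predU1P[<-|p1].
    rewrite Lnorm1 invr1 powRr1// muleC -ge0_integralZl//; last first.
      by rewrite lee_fin mulr_ge0.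
    apply: ge0_le_integral => //.
      by apply: measurable_funeM.
    move=> x _; rewrite /= normrM mulrC EFinM; apply: lee_wpmul2r => //.
    by rewrite lee_fin.
  have p0 : (0 < p)%R by exact: lt_trans p1.
  pose q := ((1 - p^-1)^-1)%R.
  have pV : (p^-1 < 1)%R by rewrite invf_lt1.
  have qV : (q^-1 = 1 - p^-1)%R by rewrite invrK.
  have q0 : (0 < q)%R by rewrite invr_gt0 subr_gt0.
  have pq : (p^-1 + q^-1 = 1)%R by rewrite qV addrC subrK.
  have q1 : (1 <= q)%R by rewrite -(invrK q) qV invf_ge1 ?subr_gt0// lerBlDr lerDl invr_ge0 ltW.
  have := hoelder mu mf mg p0 q0 pq; rewrite Lnorm1 => /le_trans; apply.
  apply: lee_wpmul2l; first exact: Lnorm_ge0.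
  rewrite unlock /=.
  have Ac0 : (0 < A * c)%R by rewrite mulr_gt0.
  (* From |g|^q <= (A c)^(q-1) |g|: the sup bound serves for q - 1 factors and the L^1 bound for
     one. The q-th root is A^(1/p) c because (q-1)/q = 1/p. *)
  have H : \int[mu]_x (`|(g x)%:E| `^ q) <= ((A * c) `^ (q - 1) * c)%:E.
    apply: (@le_trans _ _ (\int[mu]_x (((A * c) `^ (q - 1))%:E * `|(g x)%:E|))).
      apply: ge0_le_integral => //.
      + by move=> x _; exact: poweR_ge0.
      + exact: measurableT_comp (measurable_poweR q) mgE.
      + by apply: measurable_funeM.
      + move=> x _; rewrite /= lee_fin.
        have [g0|g0] := eqVneq (g x) 0%R.
          by rewrite g0 normr0 powR0 ?mulr0// gt_eqF.
        have gp : (0 < `|g x|)%R by rewrite normr_gt0.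
        rewrite -{1}(subrK 1%R q) powRD; last by rewrite (gt_eqF gp) implybT.
        rewrite powRr1//; apply: ler_wpM2r => //.
        by apply: ge0_ler_powR; rewrite ?nnegrE ?subr_ge0// ltW.
    rewrite ge0_integralZl//; last by rewrite lee_fin powR_ge0.
    by rewrite EFinM; apply: lee_wpmul2l => //; rewrite lee_fin powR_ge0.
  apply: (@le_trans _ _ (((A * c) `^ (q - 1) * c)%:E `^ q^-1)).
    apply: gt0_ler_poweR => //.
    + by rewrite invr_ge0 (ltW q0).
    + by rewrite in_itv/= leey andbT integral_ge0// => x _; exact: poweR_ge0.
    + by rewrite in_itv/= leey andbT lee_fin mulr_ge0 ?powR_ge0.
  rewrite poweR_EFin lee_fin powRM ?powR_ge0// -powRrM.
  rewrite (_ : (q - 1) * q^-1 = p^-1)%R; last first.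
    by rewrite mulrBl mul1r divff ?gt_eqF// qV; ring.
  rewrite powRM// -mulrA -powRD; last by rewrite (gt_eqF c0) implybT.
  by rewrite pq powRr1.
(* For p = +oo the L^1 bound of [g] suffices, and A^0 = 1. The hypothesis on [mu] excludes the
   convention that this norm is 0 for the zero measure. *)
- rewrite unlock /= mu0 powRr0 mul1r.
  have := ess_sup_ge mu (abse \o (EFin \o f)).
  have : 0 <= ess_sup mu (abse \o (EFin \o f)).
    by apply: ess_sup_gee => //; apply: aeW => x; exact: abse_ge0.
  case: (ess_sup _ _) => [r r0 fr|_ _|//]; last by rewrite gt0_mulye ?leey.
  apply: (@le_trans _ _ (\int[mu]_x (r%:E * `|(g x)%:E|))).
    apply: ae_ge0_le_integral => //.
    + by move=> x _; apply: mule_ge0.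
    + by apply: measurable_funeM.
    + apply: filterS fr => x fx _; rewrite normrM EFinM.
      by apply: lee_wpmul2r.
  rewrite ge0_integralZl//.
  by apply: lee_wpmul2l.
Qed.

End hoelder_weighted.

Section coefficient_bound.
Context (R : realType) (s : nat).
Implicit Types (v : {set 'I_s}) (G : 'rV[R]_s -> R).
Local Notation RR := (measurableTypeR R).
Local Notation lamT := (lebesgue_tuple R).

Definition restrict_tuple (T : Type) v (k : 'I_s -> T) : #|v|.-tuple T :=
  [tuple of map k (enum_tuple v)].

Lemma component_restrict (T : Type) v (dflt : T) (k : 'I_s -> T) i : i \in v ->
  component dflt (restrict_tuple v k) i = k i.
Proof.
move=> iv; rewrite /component /= (nth_map i) ?nth_index ?mem_enum//.
by rewrite index_mem mem_enum.
Qed.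

Lemma extend0_restrict v (k : 'I_s -> nat) : (forall i, i \notin v -> k i = 0%N) ->
  extend0 (restrict_tuple v k) = k.
Proof.
move=> k0; apply/funext => i; rewrite /extend0; case: ifPn => [|/k0 ->//].
exact: component_restrict.
Qed.

Lemma glue_updates v (t : #|v|.-tuple RR) (u : #|~: v|.-tuple RR) :
  glue_point t u = updates (updates 0 (enum v) t) (enum (~: v)) u.
Proof.
apply/rowP => i; rewrite !mxE !mem_enum inE /component.
by case: (i \in v).
Qed.

Lemma perm_enum_set v : perm_eq (enum 'I_s) (enum (~: v) ++ enum v).
Proof.
apply: uniq_perm; first exact: enum_uniq.
  rewrite cat_uniq !enum_uniq andbT /=; apply/hasPn => i.
  by rewrite !mem_enum inE => ->.
by move=> i; rewrite mem_cat !mem_enum !inE orNb.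
Qed.

(* Integrate first over the free coordinates, those outside v. *)
Lemma averages_weighted_norm v F (g : 'I_s -> R -> R) (p : \bar R) (A c : R) :
  {within @closed_cube R s, continuous F} ->
  (forall i, bounded_measurable (g i)) ->
  (forall i, i \notin v -> g i = fun=> 1) -> (1 <= p)%E -> 0 < A -> 0 < c ->
  (forall x : 'rV[R]_s, `|\prod_(i in v) g i (x 0 i)| <= A * c) ->
  \prod_(i in v) mean (fun t => `|g i t|) <= c ->
  (`|averages (enum 'I_s) (weighted F g) 0|%:E <=
    Lnorm (lamT #|v|) p ((fun t : #|v|.-tuple RR =>
      \int[lamT #|~: v|]_(u in @cubeT R #|~: v|) (F (glue_point t u))%:E)
      \_ (@cubeT R #|v|)) * (A `^ fine p^-1 * c)%:E)%E.
Proof.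
move=> cF bg g1 p1 A0 c0 gA gc.
have tF := tame_clamp cF.
pose K (x : 'rV[R]_s) := \prod_(i in v) g i (x 0 i).
have tK : tame K.
  rewrite (_ : K = (fun x => \prod_(i <- enum v) g i (x 0 i))).
    by apply: tame_prod => i; exact: tame_coord.
  by apply/funext => x; rewrite big_enum.
(* The inner integral of [partial_norm], over the variables outside [v], where all weights are 1. *)
pose B := averages (enum (~: v)) (F \o @clamp R s).
have tB : tame B by exact: tame_averages.
have wE : averages (enum 'I_s) (weighted F g) 0 = averages (enum v) (fun x => B x * K x) 0.
  rewrite (perm_averages (tame_weighted cF bg) (perm_enum_set v)) averages_cat.
  congr (averages _ _ 0); apply/funext => x.
  rewrite (@eq_averages _ _ _ _ (fun z => K x * F (clamp z))).
    by rewrite averagesZ// mulrC.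
  move=> z _ zx; rewrite /weighted mulrC; congr (_ * _).
  rewrite (bigID (mem v))/= [X in _ * X]big1 ?mulr1; last first.
    by move=> i iv; rewrite g1.
  by apply: eq_bigr => i iv; rewrite zx// mem_enum inE iv.
have mC := @measurable_cube R #|v|.
pose h G (t : #|v|.-tuple RR) := ((fun t => G (updates 0 (enum v) t)) \_ (@cubeT R #|v|)) t.
have mh G : tame G -> measurable_fun setT (h G).
  move=> tG; apply/(measurable_restrictT _ mC); apply: measurable_funTS.
  by case: (bm_updates 0 (enum v) #|v| tG).
have hE G : tame G -> (\int[lamT #|v|]_t `|(h G t)%:E| =
    (averages (enum v) (fun x => `|G x|%R) 0)%:E)%E.
  move=> tG; rewrite -(integral_averages _ (tame_norm tG) (esym (cardE v))).
  rewrite [RHS]integral_mkcond; apply: eq_integral => t _.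
  by rewrite /h !patchE; case: ifP => // _; rewrite abse0.
have -> : (fun t : #|v|.-tuple RR => (\int[lamT #|~: v|]_(u in @cubeT R #|~: v|)
    (F (glue_point t u))%:E)%E) \_ (@cubeT R #|v|) = EFin \o h B.
  apply/funext => t; rewrite /h /= !patchE; case: ifPn => // /set_mem tc.
  rewrite /B -(integral_averages _ tF (esym (cardE (~: v)))).
  apply: eq_integral => u /set_mem uc; rewrite glue_updates /= clamp_id// => i.
  rewrite !mxE !mem_enum inE; case: (boolP (i \in v)) => iv /=.
    have := tc (cast_ord (esym (cardE v)) (Ordinal (etrans (index_mem i (enum v)) (etrans (mem_enum _ _) iv)))).
    by rewrite (tnth_nth 0)/= => /andP[-> /ltW].
  have iv' : (index i (enum (~: v)) < #|~: v|)%N.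
    by rewrite cardE index_mem mem_enum inE.
  by have := uc (Ordinal iv'); rewrite (tnth_nth 0)/= => /andP[-> /ltW].
have mu0 : (0 < lamT #|v| setT)%E.
  apply: (@lt_le_trans _ _ (lamT #|v| (@cubeT R #|v|))).
    by rewrite lebesgue_tuple_cube.
  by apply: le_measure; rewrite ?inE.
have hK : (\int[lamT #|v|]_t `|(h K t)%:E| <= c%:E)%E.
  rewrite hE// lee_fin; apply: le_trans gc.
  rewrite (@eq_averages _ _ _ _ (fun x => \prod_(i <- enum v) `|g i (x 0 i)|)); last first.
    by move=> x _ _; rewrite normr_prod big_enum.
  rewrite (@averages_coord _ _ (enum v) (fun i t => `|g i t|)) ?enum_uniq//.
    by rewrite big_enum.
  by move=> i; exact: bm_norm.
have hA t : `|h K t| <= A * c.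
  rewrite /h patchE; case: ifP => _; first exact: gA.
  by rewrite normr0 mulr_ge0// ltW.
apply: le_trans (hoelder_interpolation mu0 p1 (mh _ tB) (mh _ tK) A0 c0 hA hK).
rewrite wE; apply: (@le_trans _ _ (averages (enum v) (fun x => `|B x * K x|) 0)%:E).
  by rewrite lee_fin; apply: ler_norm_averages; exact: tameM.
rewrite -hE; last exact: tameM.
rewrite le_eqVlt; apply/orP; left; apply/eqP; apply: eq_integral => t _.
by rewrite /h !patchE; case: ifP => // _; rewrite mulr0.
Qed.

Lemma take_order_size alpha (l : seq nat) :
  take_order alpha l = take (size (take_order alpha l)) l.
Proof.
case: alpha => [a|] /=; last by rewrite take_size.
by rewrite size_take_min; case: (leqP a (size l)) => // al; rewrite take_size take_oversize// ltnW.
Qed.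

(** A nonzero index has a digit 1, so at least one integration by parts takes place in each variable
    of its support: the orders are at least 1, as the supremum in [B_norm] demands. *)
Lemma exponents_gt0 M k : (0 < k < 2 ^ M)%N -> (0 < size (exponents M k))%N.
Proof.
elim: M k => [|M IH] k; first by rewrite expn0; lia.
rewrite exponentsS size_cat size_map size_nseq expnS => kM.
case: (boolP (odd k)) => [|ok] /=; first lia.
have : (0 < size (exponents M k./2))%N by apply: IH; lia.
lia.
Qed.

Lemma walsh0 M : walsh M 0 = fun _ : R => 1.
Proof.
elim: M => [//|M IH] /=; rewrite IH; apply/funext => t.
by rewrite /stretch mulr1; case: ifP.
Qed.

(** The orders are a_i = min(alpha, N_i), with N_i the number of digits 1 of k_i: the primitives
    before that order have mean 0, and [f] has the derivatives. They depend on [k], hence the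
    supremum over orders in the norm. *)
Lemma walsh_coefficient_le alpha (f : 'rV[R]_s -> R) (p : \bar R) (M : nat)
    (k : 'I_s -> nat) v :
  le_order 1 alpha -> continuous_mixed_partials alpha f -> (1 <= p)%E ->
  (forall i, (k i < 2 ^ M)%N) -> (forall i, (i \in v) = (k i != 0%N)) ->
  exists2 a : #|v|.-tuple nat,
    forall i, (1 <= tnth a i)%N /\ le_order (tnth a i) alpha &
  (`|walsh_coefficient M f k|%:E <=
    partial_norm p f a * (2 `^ (#|v|%:R * fine p^-1) *
      2 ^- mu' alpha (restrict_tuple v k))%:E)%E.
Proof.
move=> alpha1 hf p1 kM vk.
pose l i := exponents M (k i).
pose a i := size (take_order alpha (l i)).
have al i : (a i <= size (l i))%N.
  by rewrite /a; case: (alpha) => //= b; rewrite size_take_min geq_minr.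
have aalpha i : le_order (a i) alpha.
  by rewrite /a; case: (alpha) => //= b; rewrite size_take_min geq_minl.
have k0 i : i \notin v -> k i = 0%N by rewrite vk negbK => /eqP.
have l0 i : i \notin v -> l i = [::].
  move=> /k0 ki; rewrite /l ki /exponents (eq_filter (a2 := pred0)) ?filter_pred0//.
  by move=> j; rewrite /= /bit div0n.
have a0 i : i \notin v -> a i = 0%N.
  by move=> /l0 li; apply/eqP; rewrite -leqn0 (leq_trans (al i))// li.
have a_gt0 i : i \in v -> (0 < a i)%N.
  rewrite vk => ki; have := @exponents_gt0 M (k i).
  rewrite kM lt0n ki => /(_ isT); rewrite /a -/(l i).
  by case: (alpha) alpha1 => //= b b1 li; rewrite size_take_min leq_min b1.
exists (restrict_tuple v a).
  move=> i; rewrite tnth_map; split; last exact: aalpha.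
  by apply: a_gt0; rewrite -mem_enum; exact: mem_tnth.
pose g i : R -> R := walsh_prim M (k i) (a i).
have B i := walsh_prim_bounds R M (k i).
have -> : `|walsh_coefficient M f k| =
    `|averages (enum 'I_s) (weighted (mixed_partial a f) g) 0|.
  rewrite /walsh_coefficient (averages_partials 0 hf aalpha); last 2 first.
  - by move=> i; exact: bm_walsh.
  - move=> i j ja; have [H _ _ _] := B i; apply: (H j).
    exact: leq_trans ja (al i).
  by rewrite normrM normrX normrN1 expr1n mul1r.
pose c : R := 2 ^- mu' alpha (restrict_tuple v k).
pose wt i := weight (take (a i) (l i)).
have cE : c = \prod_(i in v) 2 ^- wt i.
  rewrite /c /mu' /= big_map big_enum /=.
  rewrite (big_morph (fun n => 2 ^- n : R) (id1 := 1) (op1 := *%R)); last 2 first.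
  - by move=> x y; rewrite exprD invfM.
  - by rewrite expr0 invr1.
  apply: eq_bigr => i _; rewrite /wt /weight /a /l -take_order_size.
  by rewrite (dyadic_exponentsE (kM i)).
have c0 : 0 < c by rewrite invr_gt0 exprn_gt0.
(* The constant A is 2^|v|: each variable of [v] contributes the factor 2 between the sup bound and
   the L^1 bound of its primitive. *)
have AE : 2 `^ (#|v|%:R * fine p^-1) = (2 ^+ #|v|) `^ fine p^-1 :> R.
  by rewrite powRrM powR_mulrn.
rewrite AE /partial_norm extend0_restrict//.
apply: averages_weighted_norm => //.
- have [_ cw] := hf a aalpha; exact: cw.
- by move=> i; exact: bm_walsh_prim.
- by move=> i iv; rewrite /g a0// k0//; exact: walsh0.
- move=> x; rewrite -/c cE -[2 ^+ _]prodr_const -big_split /= normr_prod.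
  apply: ler_prod => i iv; rewrite normr_ge0 /=.
  by have [_ _ H _] := B i; apply: H; rewrite a_gt0//=.
- rewrite -/c cE; apply: ler_prod => i iv; have [_ H _ _] := B i.
  by rewrite mean_ge0//=; exact: H.
Qed.

End coefficient_bound.

(** * The inequality *)

Section hoelder_sums.
Context (R : realType).

(** Induction on the list: the two-term inequality is applied to the head and to the norms of the
    tail. *)
Lemma hoelder_sum (I : Type) (r : seq I) (P : pred I) (x y : I -> R) (p q : R) :
  (forall i, 0 <= x i) -> (forall i, 0 <= y i) ->
  0 < p -> 0 < q -> p^-1 + q^-1 = 1 ->
  \sum_(i <- r | P i) x i * y i <=
    (\sum_(i <- r | P i) x i `^ p) `^ p^-1 *
    (\sum_(i <- r | P i) y i `^ q) `^ q^-1.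
Proof.
move=> x0 y0 p0 q0 pq; elim: r => [|i r IH].
  by rewrite !big_nil mulr_ge0// powR_ge0.
rewrite !big_cons; case: ifP => // _.
set X := \sum_(j <- r | P j) x j `^ p; set Y := \sum_(j <- r | P j) y j `^ q.
have X0 : 0 <= X by apply: sumr_ge0 => j _; exact: powR_ge0.
have Y0 : 0 <= Y by apply: sumr_ge0 => j _; exact: powR_ge0.
have := @hoelder2 R (x i) (X `^ p^-1) (y i) (Y `^ q^-1) p q
  (x0 i) (powR_ge0 _ _) (y0 i) (powR_ge0 _ _) p0 q0 pq.
rewrite -!powRrM !mulVf ?gt_eqF// !powRr1//.
by apply: le_trans; rewrite lerD2l.
Qed.

(** Since 0 * +oo = 0, the vanishing norms are treated first; then an infinite norm, multiplied by a
    positive one, makes the right-hand side infinite. The remaining case is real-valued. *)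
Lemma ge0_hoelder_sum (I : finType) (P : pred I) (F G : I -> \bar R) (p q : R) :
  (forall i, 0 <= F i)%E -> (forall i, 0 <= G i)%E ->
  0 < p -> 0 < q -> p^-1 + q^-1 = 1 ->
  (\sum_(i | P i) F i * G i <=
    (\sum_(i | P i) F i `^ p) `^ p^-1 * (\sum_(i | P i) G i `^ q) `^ q^-1)%E.
Proof.
move=> F0 G0 p0 q0 pq.
have le_term (H : I -> \bar R) (r : R) i : (forall i, 0 <= H i)%E -> P i ->
    (H i `^ r <= \sum_(i | P i) H i `^ r)%E.
  move=> H0 Pi; rewrite (bigD1 i)//= leeDl// sume_ge0// => j _.
  exact: poweR_ge0.
have eq0 (H : I -> \bar R) (r : R) i : (forall i, 0 <= H i)%E -> P i ->
    (\sum_(i | P i) H i `^ r = 0 -> H i = 0)%E.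
  move=> H0 Pi S0; apply: (@poweR_eq0_eq0 _ _ r) => //.
  by apply/eqP; rewrite eq_le poweR_ge0 andbT -S0; exact: le_term.
have finS (H : I -> \bar R) (r : R) i : 0 < r -> (forall i, 0 <= H i)%E -> P i ->
    (\sum_(i | P i) H i `^ r < +oo)%E -> H i \is a fin_num.
  move=> r0 H0 Pi Soo; rewrite ge0_fin_numE//.
  apply: (@lty_poweRy _ _ r); first by rewrite gt_eqF.
  exact: le_lt_trans (le_term H r i H0 Pi) Soo.
set X := (\sum_(i | P i) F i `^ p)%E; set Y := (\sum_(i | P i) G i `^ q)%E.
have X0 : (0 <= X)%E by apply: sume_ge0 => i _; exact: poweR_ge0.
have Y0 : (0 <= Y)%E by apply: sume_ge0 => i _; exact: poweR_ge0.
have [XE|XN] := eqVneq X 0%E.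
  rewrite big1 ?mule_ge0 ?poweR_ge0// => i Pi.
  by rewrite (eq0 F p i)// mul0e.
have [YE|YN] := eqVneq Y 0%E.
  rewrite big1 ?mule_ge0 ?poweR_ge0// => i Pi.
  by rewrite (eq0 G q i)// mule0.
have Xp : (0 < X `^ p^-1)%E by apply: poweR_gt0; rewrite lt0e XN.
have Yp : (0 < Y `^ q^-1)%E by apply: poweR_gt0; rewrite lt0e YN.
have [XE|XN'] := eqVneq X +oo%E.
  by rewrite [X in (X `^ _)%E]XE poweRyr ?gt0_mulye ?leey// gt_eqF ?invr_gt0.
have [YE|YN'] := eqVneq Y +oo%E.
  by rewrite [X in (_ * X `^ _)%E]YE poweRyr ?gt0_muley ?leey// gt_eqF ?invr_gt0.
have fF i : P i -> F i = (fine (F i))%:E.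
  by move=> Pi; rewrite fineK//; apply: (finS F p i) => //; rewrite ltey.
have fG i : P i -> G i = (fine (G i))%:E.
  by move=> Pi; rewrite fineK//; apply: (finS G q i) => //; rewrite ltey.
rewrite (eq_bigr (fun i => (fine (F i) * fine (G i))%:E)); last first.
  by move=> i Pi; rewrite {1}fF// {1}fG.
rewrite /X /Y.
rewrite [X in ((X `^ _) * _)%E](eq_bigr (fun i => (fine (F i) `^ p)%:E)); last first.
  by move=> i Pi; rewrite {1}fF.
rewrite [X in (_ * (X `^ _))%E](eq_bigr (fun i => (fine (G i) `^ q)%:E)); last first.
  by move=> i Pi; rewrite {1}fG.
rewrite !sumEFin !poweR_EFin -EFinM lee_fin.
by apply: hoelder_sum => // i; exact: fine_ge0.
Qed.

Lemma lq_hoelder (s : nat) (F G : {set 'I_s} -> \bar R) (q q' : \bar R) :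
  (forall v, 0 <= F v)%E -> (forall v, 0 <= G v)%E ->
  (1 <= q)%E -> (1 <= q')%E -> (q^-1 + q'^-1 = 1)%E ->
  (\sum_(v : {set 'I_s} | v != finset.set0) F v * G v <=
    lq_norm q' F * lq_norm q G)%E.
Proof.
move=> F0 G0.
(* Covers both end cases, where one exponent is 1 and the other infinite. *)
have sum_max (K H : {set 'I_s} -> \bar R) : (forall v, 0 <= K v)%E -> (forall v, 0 <= H v)%E ->
    (\sum_(v : {set 'I_s} | v != finset.set0) K v * H v <=
     (\sum_(v : {set 'I_s} | v != finset.set0) K v `^ 1) `^ 1^-1 *
     \big[maxe/0]_(v : {set 'I_s} | v != finset.set0) H v)%E.
  move=> K0 H0; rewrite invr1.
  have -> : (\sum_(v : {set 'I_s} | v != finset.set0) K v `^ 1 =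
      \sum_(v : {set 'I_s} | v != finset.set0) K v)%E.
    by apply: eq_bigr => v _; rewrite poweRe1.
  rewrite poweRe1 ?sume_ge0// ge0_sume_distrl//.
  apply: lee_sum => v v0; apply: lee_wpmul2l => //.
  exact: le_bigmax_cond.
case: q => [q|_|//]; last first.
  move=> q'1; rewrite invey add0e => /eqP; rewrite inve_eq1 => /eqP ->.
  exact: sum_max.
case: q' => [q'|q1 _|//]; last first.
  rewrite invey adde0 => /eqP; rewrite inve_eq1 => /eqP ->.
  by under eq_bigr do rewrite muleC; rewrite muleC; exact: sum_max.
rewrite !lee_fin => q1 q'1.
have q0 : 0 < q by exact: lt_le_trans q1.
have q'0 : 0 < q' by exact: lt_le_trans q'1.
rewrite !inver !gt_eqF// -EFinD => -[qq'].
by apply: ge0_hoelder_sum => //; rewrite addrC.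
Qed.

End hoelder_sums.

(** [esum] is a supremum of finite sums, so a finite sum over an injective image is one of its
    competitors; no summability is involved. *)
Lemma sum_le_esum (R : realType) (K : finType) (T : choiceType) (P : pred K)
    (phi : K -> T) (A : set T) (a : T -> \bar R) :
  {in P &, injective phi} -> (forall k, P k -> A (phi k)) ->
  (\sum_(k | P k) a (phi k) <= \esum_(t in A) a t)%E.
Proof.
move=> phi_inj PA; pose r := [seq phi k | k <- enum P].
have ur : uniq r.
  rewrite map_inj_in_uniq ?enum_uniq// => k k'; rewrite !mem_enum.
  exact: phi_inj.
apply: esum_ge; exists [set` r].
  split; first exact: finite_seq.
  by move=> t /= /mapP[k]; rewrite mem_enum => /PA Ak ->.
by rewrite -fsbig_seq// big_map big_enum.
Qed.

(** * Summation over the dual net by supports *)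

Section error_bound.
Context (R : realType) (s n m : nat) (C : 'I_s -> 'M['F_2]_(n, m)).

Definition support (M : nat) (k : {ffun 'I_s -> 'I_(2 ^ M)}) : {set 'I_s} :=
  [set i | k i != 0%N :> nat]%SET.

(** The orders supplied by [walsh_coefficient_le] vary with [k]; the supremum makes them a common
    factor. Indices with support [v] are determined by their restriction to [v], which lies in the
    dual net on [v]. *)
Lemma sum_walsh_coefficient_le alpha (f : 'rV[R]_s -> R) (p : \bar R) M
    (v : {set 'I_s}) :
  le_order 1 alpha -> continuous_mixed_partials alpha f -> (1 <= p)%E ->
  ((\sum_(k : {ffun 'I_s -> 'I_(2 ^ M)} |
      dualb C (fun i => k i) && (support k == v))
        `|walsh_coefficient M f (fun i => k i)|)%:E <=
   ((2 `^ (#|v|%:R * fine p^-1))%:E *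
     ereal_sup [set partial_norm p f a | a in
       [set a : #|v|.-tuple nat |
         forall i, (1 <= tnth a i)%N /\ le_order (tnth a i) alpha]]) *
   \esum_(k in dual_net_on C v) (2 ^- mu' alpha k)%:E)%E.
Proof.
move=> alpha1 hf p1.
set c := 2 `^ _; set S := ereal_sup _.
pose phi (k : {ffun 'I_s -> 'I_(2 ^ M)}) := restrict_tuple v (fun i => k i : nat).
pose P (k : {ffun 'I_s -> 'I_(2 ^ M)}) := dualb C (fun i => k i) && (support k == v).
have c0 : 0 < c by exact: powR_gt0.
have vE k i : P k -> (i \in v) = (k i != 0%N :> nat).
  by move=> /andP[_ /eqP <-]; rewrite inE.
have S0 : (0 <= S)%E.
  have pn0 (a : #|v|.-tuple nat) : (0 <= partial_norm p f a)%E by exact: Lnorm_ge0.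
  apply: (@le_trans _ _ (partial_norm p f [tuple of nseq #|v| 1%N])) => //.
  apply: ereal_sup_ubound; exists [tuple of nseq #|v| 1%N] => // i.
  by rewrite tnth_nseq.
apply: (@le_trans _ _ (c%:E * S * \sum_(k | P k) (2 ^- mu' alpha (phi k))%:E)%E).
  rewrite -sumEFin ge0_sume_distrr; last by move=> k _; rewrite lee_fin.
  apply: lee_sum => k Pk.
  have [a aP] := @walsh_coefficient_le R s alpha f p M (fun i => k i) v alpha1 hf p1
    (fun i => ltn_ord (k i)) (fun i => vE k i Pk).
  move=> /le_trans; apply; rewrite EFinM muleA [(_ * c%:E)%E]muleC.
  apply: lee_wpmul2r; first by rewrite lee_fin.
  apply: lee_wpmul2l; first by rewrite lee_fin ltW.
  by apply: ereal_sup_ubound; exists a.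
apply: lee_wpmul2l; first by rewrite mule_ge0// lee_fin ltW.
apply: (@sum_le_esum R _ _ P phi _ (fun t => (2 ^- mu' alpha t)%:E)).
  move=> k k' Pk Pk' kk'; apply/ffunP => i; apply/val_inj => /=.
  have [iv|iv] := boolP (i \in v).
    have := congr1 (fun t => component 0%N t i) kk'.
    by rewrite !component_restrict.
  have := iv; rewrite (vE k i Pk) negbK => /eqP ->.
  by move: iv; rewrite (vE k' i Pk') negbK => /eqP ->.
move=> k Pk; split.
  move=> i; rewrite tnth_map lt0n -(vE k _ Pk) -mem_enum; exact: mem_tnth.
rewrite extend0_restrict; last by move=> i; rewrite (vE k i Pk) negbK => /eqP.
by apply/dualP; case/andP: Pk.
Qed.

End error_bound.

Theorem theorem1p1 (R : realType) (s : nat) (hs : (1 <= s)%N)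
    (n m : nat) (hm : (1 <= m)%N) (hmn : (m <= n)%N)
    (C : 'I_s -> 'M['F_2]_(n, m))
    (gamma : {set 'I_s} -> R) (hgamma : forall v, 0 < gamma v)
    (alpha : option nat) (halpha : le_order 2 alpha)
    (f : 'rV[R]_s -> R) (hf : continuous_mixed_partials alpha f)
    (p q q' : \bar R) (hp : (1 <= p)%E) (hq : (1 <= q)%E) (hq' : (1 <= q')%E)
    (hqq' : (q^-1 + q'^-1 = 1)%E) :
  (`|Err f (digital_net R C)|%:E <=
     B_norm alpha gamma p q' f * W alpha gamma q C)%E.
Proof.
have alpha1 : le_order 1 alpha by case: alpha halpha {hf} => //= a /ltnW.
have cf : {within @closed_cube R s, continuous f}.
  have [_] := hf (fun=> 0%N) (fun i => ltac:(by case: (alpha))).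
  (* With order 0 in every variable the mixed partial derivative is [f] itself. *)
  rewrite /mixed_partial (_ : variables _ = [::])//.
  by apply/size0nil; rewrite /variables size_flatten /shape -map_comp sumnE big_map big1.
rewrite /B_norm /W.
set N := fun v : {set 'I_s} => (_ * ereal_sup _)%E.
set G := fun v : {set 'I_s} => (_ * esum _ _)%E.
have N0 v : (0 <= N v)%E.
  rewrite /N mule_ge0//.
    by rewrite lee_fin mulr_ge0 ?powR_ge0// invr_ge0 ltW.
  have pn0 (a : #|v|.-tuple nat) : (0 <= partial_norm p f a)%E by exact: Lnorm_ge0.
  apply: (@le_trans _ _ (partial_norm p f [tuple of nseq #|v| 1%N])) => //.
  apply: ereal_sup_ubound; exists [tuple of nseq #|v| 1%N] => // i.
  by rewrite tnth_nseq.
have G0 v : (0 <= G v)%E.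
  by rewrite /G mule_ge0 ?lee_fin ?(ltW (hgamma v))// esum_ge0// => k _; rewrite lee_fin.
apply: le_trans (lq_hoelder N0 G0 hq hq' hqq').
(* The finite Walsh sum depends on [e] through [M], but its bound does not, so an arbitrary [e]
   suffices. *)
apply/lee_addgt0Pr => e e0.
have [M] := Err_le_walsh C cf e0.
rewrite -lee_fin => /le_trans; apply; rewrite EFinD addeC; apply: leeD => //.
rewrite (partition_big (@support s M) (fun v => v != finset.set0))/=; last first.
  move=> k /andP[_ /existsP[i ki]]; apply/set0Pn; exists i; by rewrite inE.
rewrite -sumEFin; apply: lee_sum => v v0.
apply: (@le_trans _ _ (\sum_(k : {ffun 'I_s -> 'I_(2 ^ M)} |
      dualb C (fun i => k i) && (support k == v))
        `|walsh_coefficient M f (fun i => k i)|)%:E).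
  rewrite lee_fin le_eqVlt; apply/orP; left; apply/eqP; apply: eq_bigl => k.
  case: eqP => [kv|]; rewrite ?andbF// !andbT; case: (dualb _ _) => //=.
  by move: v0; rewrite -kv => /set0Pn[i]; rewrite inE => ki; apply/existsP; exists i.
apply: le_trans (sum_walsh_coefficient_le C M v alpha1 hf hp) _.
rewrite le_eqVlt; apply/orP; left; apply/eqP.
(* The weight [gamma v] of [W] cancels against its inverse in [B_norm]. *)
rewrite /N /G [RHS]muleACA -EFinM -mulrA [_ * gamma v]mulrC mulrA mulVf ?mul1r ?gt_eqF//.
by rewrite muleA.
Qed.
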